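(* Let $\mu$ be a distribution on $\Sigma\times\Gamma\times\Phi$ (finite sets), $\Sigma'\subseteq\Sigma$, and $T:\mathsf{supp}(\mu)\to\mathbb{D}$ nonembeddable over $\mathbb{D}$, such that $(\mu,\Sigma',T)$ satisfies the relaxed base case. Then there are constants $c=c(T,\mu)>0$ and $C=C(T,\mu)>0$ such that for all $n$, $d$, all $G:\Gamma^n\to\mathbb{C}$, $H:\Phi^n\to\mathbb{C}$, and every $F:\Sigma^n\to\mathbb{C}$ that is effectively homogeneous of effective degree $d$, $$\left|\mathbb{E}_{(x,y,z)\sim\mu^{\otimes n}}\Big[F(x)G(y)H(z)\prod_{i=1}^nT(x_i,y_i,z_i)\Big]\right|\le 2^{-c\cdot d(d/n)^C}\|F\|_2\|G\|_2\|H\|_2.$$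
   Context: $\mathbb{D}$ is the closed unit disk. $T$ is nonembeddable over $\mathbb{D}$ if there are no $A:\Sigma\to\mathbb{D}$, $B:\Gamma\to\mathbb{D}$, $C:\Phi\to\mathbb{D}$ with $A(x)B(y)C(z)T(x,y,z)=1$ on $\mathsf{supp}(\mu)$. Norms are $L_2$ norms with respect to the marginals $\mu_x^{\otimes n},\mu_y^{\otimes n},\mu_z^{\otimes n}$ (resp. $\mu_x,\mu_y,\mu_z$ for $n=1$). Let $M=\max\{|\Sigma|,|\Gamma|,|\Phi|\}$. For $F:\Sigma\to\mathbb{C}$ put $I_{\mathsf{eff}}[F]=\mathbb{E}_{x,x'\sim\mu_x\text{ indep.}}[1_{x,x'\in\Sigma'}|F(x)-F(x')|^2]$. $(\mu,\Sigma',T)$ satisfies the relaxed base case if: (i) the marginal $\mu_{y,z}$ is a product distribution; (ii) for $(x,y,z)\in\mathsf{supp}(\mu)$, $(y,z)$ determines $x$; (iii) there is a constant $c_0=c_0(T,\mu)>0$ such that for every $\tau>0$ and all $F:\Sigma\to\mathbb{C}$, $G:\Gamma\to\mathbb{C}$, $H:\Phi\to\mathbb{C}$ with $I_{\mathsf{eff}}[F]\ge\tau\|F\|_2^2$, one has $|\mathbb{E}_{(x,y,z)\sim\mu}[F(x)G(y)H(z)T(x,y,z)]|\le(1-c_0\tau^{100M})\|F\|_2\|G\|_2\|H\|_2$. Effective degree: take an orthonormal basis $B=B_1\cup B_2$ of $L_2(\Sigma,\mu_x)$ where $B_1$ is an orthonormal basis of the functions constant on $\Sigma'$ and contains the constant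 function, and $B_2$ is an orthonormal basis of the functions supported on $\Sigma'$ orthogonal to constants. For $\chi=\chi_1\otimes\cdots\otimes\chi_n\in B^{\otimes n}$, $\mathsf{effdeg}(\chi)=|\{i:\chi_i\in B_2\}|$. $F:\Sigma^n\to\mathbb{C}$ is effectively homogeneous of effective degree $d$ if $F=\sum_{\chi\in B^{\otimes n}:\,\mathsf{effdeg}(\chi)=d}\hat F(\chi)\chi$. *)

(* Defs.v *)
From HB Require Import structures.
From mathcomp Require Import all_boot all_order all_algebra.
From mathcomp Require Import all_classical all_reals.
From mathcomp Require Import exp.
From mathcomp Require Import complex.

Set Implicit Arguments.
Unset Strict Implicit.
Unset Printing Implicit Defensive.

Import Order.TTheory GRing.Theory Num.Theory.
Local Open Scope ring_scope.

Definition cR {R : realType} (r : R) : R[i] := Complex r 0.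
Definition cconj {R : realType} (z : R[i]) : R[i] :=
  let: Complex a b := z in Complex a (- b).
Definition cabs2 {R : realType} (z : R[i]) : R :=
  let: Complex a b := z in a ^+ 2 + b ^+ 2.
Definition cabs {R : realType} (z : R[i]) : R := Num.sqrt (cabs2 z).
Definition inD {R : realType} (z : R[i]) : Prop := cabs z <= 1.

Section Dist.
Context {R : realType} {Sg Gm Ph : finType}.
Implicit Types (mu : Sg * Gm * Ph -> R).

Definition is_distr mu : Prop :=
  (forall t, 0 <= mu t) /\ \sum_t mu t = 1.

Definition margx mu (a : Sg) : R := \sum_(b : Gm) \sum_(c : Ph) mu (a, b, c).
Definition margy mu (b : Gm) : R := \sum_(a : Sg) \sum_(c : Ph) mu (a, b, c).
Definition margz mu (c : Ph) : R := \sum_(a : Sg) \sum_(b : Gm) mu (a, b, c).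
Definition margyz mu (b : Gm) (c : Ph) : R := \sum_(a : Sg) mu (a, b, c).

Definition nonembeddable mu (T : Sg -> Gm -> Ph -> R[i]) : Prop :=
  ~ exists (A : Sg -> R[i]) (B : Gm -> R[i]) (C : Ph -> R[i]),
      [/\ (forall a, inD (A a)), (forall b, inD (B b)), (forall c, inD (C c)) &
          forall a b c, 0 < mu (a, b, c) -> A a * B b * C c * T a b c = 1].
End Dist.

Definition norm1 {R : realType} {X : finType} (p : X -> R) (f : X -> R[i]) : R :=
  Num.sqrt (\sum_x p x * cabs2 (f x)).

Definition prodw {R : realType} {X : finType} (n : nat) (p : X -> R)
  (x : {ffun 'I_n -> X}) : R := \prod_i p (x i).

Definition normn {R : realType} {X : finType} (n : nat) (p : X -> R)
  (f : {ffun 'I_n -> X} -> R[i]) : R :=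
  Num.sqrt (\sum_x prodw p x * cabs2 (f x)).

Definition ip1 {R : realType} {X : finType} (p : X -> R) (f g : X -> R[i]) : R[i] :=
  \sum_x cR (p x) * f x * cconj (g x).

Definition Ieff {R : realType} {Sg Gm Ph : finType} (mu : Sg * Gm * Ph -> R)
  (S' : {set Sg}) (F : Sg -> R[i]) : R :=
  \sum_(a : Sg) \sum_(a' : Sg)
     margx mu a * margx mu a' * ((a \in S') && (a' \in S'))%:R * cabs2 (F a - F a').

Definition E1 {R : realType} {Sg Gm Ph : finType} (mu : Sg * Gm * Ph -> R)
  (T : Sg -> Gm -> Ph -> R[i]) (F : Sg -> R[i]) (G : Gm -> R[i]) (H : Ph -> R[i]) : R[i] :=
  \sum_t cR (mu t) * F t.1.1 * G t.1.2 * H t.2 * T t.1.1 t.1.2 t.2.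

Definition relaxed_base_case {R : realType} {Sg Gm Ph : finType}
  (mu : Sg * Gm * Ph -> R) (S' : {set Sg}) (T : Sg -> Gm -> Ph -> R[i]) : Prop :=
  let M := maxn #|Sg| (maxn #|Gm| #|Ph|) in
  [/\
      (forall b c, margyz mu b c = margy mu b * margz mu c),
      (forall a a' b c, 0 < mu (a, b, c) -> 0 < mu (a', b, c) -> a = a') &
      exists c0 : R, 0 < c0 /\
        forall tau : R, 0 < tau ->
        forall (F : Sg -> R[i]) (G : Gm -> R[i]) (H : Ph -> R[i]),
          tau * norm1 (margx mu) F ^+ 2 <= Ieff mu S' F ->
          cabs (E1 mu T F G H) <=
            (1 - c0 * tau ^+ (100 * M)) *
              norm1 (margx mu) F * norm1 (margy mu) G * norm1 (margz mu) H].

Definition bsum {R : realType} {X I1 I2 : Type} (b1 : I1 -> X -> R[i])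
  (b2 : I2 -> X -> R[i]) (s : I1 + I2) : X -> R[i] :=
  match s with inl i => b1 i | inr j => b2 j end.

Definition orthonormal {R : realType} {X I : finType} (p : X -> R)
  (b : I -> X -> R[i]) : Prop :=
  forall i j, ip1 p (b i) (b j) = ((i == j)%:R : R[i]).

(* b is an orthonormal basis of the subspace V of L2(X, p):
   members in V, orthonormal, and every f in V equals (in L2, i.e. up to a
   p-null set) a linear combination of the b i *)
Definition onb_of {R : realType} {X I : finType} (p : X -> R)
  (V : (X -> R[i]) -> Prop) (b : I -> X -> R[i]) : Prop :=
  [/\ (forall i, V (b i)), orthonormal p b &
      forall f, V f -> exists al : I -> R[i],
        norm1 p (fun x => f x - \sum_i al i * b i x) = 0].

Definition const_on {R : realType} {X : finType} (S' : {set X}) (f : X -> R[i]) : Prop :=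
  forall a a', a \in S' -> a' \in S' -> f a = f a'.

Definition supp_orth {R : realType} {X : finType} (p : X -> R) (S' : {set X})
  (f : X -> R[i]) : Prop :=
  (forall a, a \notin S' -> f a = 0) /\ ip1 p f (fun _ => 1) = 0.

Definition eff_basis {R : realType} {X I1 I2 : finType} (p : X -> R) (S' : {set X})
  (b1 : I1 -> X -> R[i]) (b2 : I2 -> X -> R[i]) : Prop :=
  [/\ onb_of p (const_on S') b1,
      (exists i, b1 i = fun _ => 1),
      onb_of p (supp_orth p S') b2 &
      onb_of p (fun _ => True) (bsum b1 b2)].

Definition tens {R : realType} {X I1 I2 : finType} (n : nat)
  (b1 : I1 -> X -> R[i]) (b2 : I2 -> X -> R[i])
  (chi : {ffun 'I_n -> (I1 + I2)%type}) (x : {ffun 'I_n -> X}) : R[i] :=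
  \prod_i bsum b1 b2 (chi i) (x i).

Definition is_inr {A B : Type} (s : A + B) : bool :=
  if s is inr _ then true else false.

Definition effdeg {I1 I2 : finType} (n : nat) (chi : {ffun 'I_n -> (I1 + I2)%type}) : nat :=
  #|[set i | is_inr (chi i)]|.

Definition fhat {R : realType} {X I1 I2 : finType} (n : nat) (p : X -> R)
  (b1 : I1 -> X -> R[i]) (b2 : I2 -> X -> R[i])
  (F : {ffun 'I_n -> X} -> R[i]) (chi : {ffun 'I_n -> (I1 + I2)%type}) : R[i] :=
  \sum_x cR (prodw p x) * F x * cconj (tens b1 b2 chi x).

(* F is effectively homogeneous of effective degree d:
   F = sum_{chi : effdeg chi = d} hat F(chi) chi  (as elements of L2) *)
Definition eff_homog {R : realType} {X I1 I2 : finType} (n : nat) (p : X -> R)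
  (b1 : I1 -> X -> R[i]) (b2 : I2 -> X -> R[i]) (d : nat)
  (F : {ffun 'I_n -> X} -> R[i]) : Prop :=
  normn p (fun x => F x -
     \sum_(chi : {ffun 'I_n -> (I1 + I2)%type} | effdeg chi == d)
        fhat p b1 b2 F chi * tens b1 b2 chi x) = 0.

Definition En {R : realType} {Sg Gm Ph : finType} (n : nat) (mu : Sg * Gm * Ph -> R)
  (T : Sg -> Gm -> Ph -> R[i])
  (F : {ffun 'I_n -> Sg} -> R[i]) (G : {ffun 'I_n -> Gm} -> R[i])
  (H : {ffun 'I_n -> Ph} -> R[i]) : R[i] :=
  \sum_(w : {ffun 'I_n -> (Sg * Gm * Ph)%type})
    cR (\prod_i mu (w i)) *
    F [ffun i => (w i).1.1] * G [ffun i => (w i).1.2] * H [ffun i => (w i).2] *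
    \prod_i T (w i).1.1 (w i).1.2 (w i).2.

(* Main.v *)
Require Import Defs.
From HB Require Import structures.
From mathcomp Require Import all_boot all_order all_algebra.
From mathcomp Require Import all_classical all_reals.
From mathcomp Require Import sequences exp.
From mathcomp Require Import complex.
From mathcomp Require Import ring lra.

(** For scalar f, g, h the form E[f g h T] pairs g (x) h with A f, where
    A : L2(Sigma) -> L2(Gamma) (x) L2(Phi) is a contraction because mu_{y,z} is a
    product and (y,z) determines x.  The base case says that product vectors are
    far from A f as soon as f has a component Q f of size tau in the span of B_2.

    The injective norm does not tensorize, so one first proves a bound for functions
    with values in Hilbert spaces.  Measure both sides with a finite product frame:
    the form is at most the Bhattacharyya coefficient of the two outcome
    distributions, one coming from A f and one from the (mixed) product state of g, h.
    The frame is informationally complete by polarization, so a coefficient close to 1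
    makes the two states close, and the witness A(1 + eta Q)A^*, which is at most
    1 + kappa on product vectors and about 1 + eta tau on A f, bounds it by
    1 - gain * tau^(2C).

    Replacing f by f + rho Q f costs at most a factor 1 + O(rho tau), hence the form
    twisted by 1 + rho Q has constant 1 + gain * t0^(2C) with rho ~ gain * t0^(2C-1),
    and this twisted bound does tensorize.  On functions of effective degree d the
    twist is multiplication by (1 + rho)^d, and t0 = d/(6n) gives the decay. *)

Import Order.TTheory GRing.Theory Num.Theory.
Local Open Scope ring_scope.

Set Implicit Arguments.
Unset Strict Implicit.
Unset Printing Implicit Defensive.

(** * Conjugation and modulus of complex numbers *)

Section ComplexModulus.
Context {R : realType}.
Implicit Types (z w : R[i]) (r s : R).

Lemma cRM r s : cR (r * s) = cR r * cR s.
Proof. exact: (rmorphM (real_complex R)). Qed.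

Lemma cRD r s : cR (r + s) = cR r + cR s.
Proof. exact: (rmorphD (real_complex R)). Qed.

Lemma cRB r s : cR (r - s) = cR r - cR s.
Proof. exact: (rmorphB (real_complex R)). Qed.

Lemma cR0 : cR 0 = 0 :> R[i].
Proof. by []. Qed.

Lemma cR1 : cR 1 = 1 :> R[i].
Proof. by []. Qed.

Lemma cR_nat n : cR (n%:R : R) = n%:R.
Proof. exact: (rmorph_nat (real_complex R)). Qed.

Lemma cR_sum (I : finType) (P : pred I) (f : I -> R) :
  cR (\sum_(i | P i) f i) = \sum_(i | P i) cR (f i).
Proof. exact: (rmorph_sum (real_complex R)). Qed.

Lemma cR_prod (I : finType) (f : I -> R) : cR (\prod_i f i) = \prod_i cR (f i).
Proof. exact: (rmorph_prod (real_complex R)). Qed.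

Lemma cconjM z w : cconj (z * w) = cconj z * cconj w.
Proof. exact: (rmorphM (@conjc R)). Qed.

Lemma cconjD z w : cconj (z + w) = cconj z + cconj w.
Proof. exact: (rmorphD (@conjc R)). Qed.

Lemma cconjN z : cconj (- z) = - cconj z.
Proof. exact: (rmorphN (@conjc R)). Qed.

Lemma cconj1 : cconj 1 = 1 :> R[i].
Proof. exact: (rmorph1 (@conjc R)). Qed.

Lemma cconj_sum (I : finType) (f : I -> R[i]) :
  cconj (\sum_i f i) = \sum_i cconj (f i).
Proof. exact: (rmorph_sum (@conjc R)). Qed.

Lemma cRI : injective (@cR R).
Proof. by move=> x y []. Qed.

Lemma cconjK : involutive (@cconj R).
Proof. by case=> a b; rewrite /cconj opprK. Qed.

Lemma cconj_cR r : cconj (cR r) = cR r.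
Proof. by rewrite /cconj /cR oppr0. Qed.

Lemma cabs2E z : cR (cabs2 z) = cconj z * z.
Proof.
case: z => a b; rewrite /cR /cabs2 /cconj; apply/eqP; rewrite eq_complex /=.
by rewrite !expr2 !mulNr opprK eqxx [b * a]mulrC subrr eqxx.
Qed.

Lemma cabs2_ge0 z : 0 <= cabs2 z.
Proof. by case: z => a b; rewrite addr_ge0 // sqr_ge0. Qed.

Lemma cabs2M z w : cabs2 (z * w) = cabs2 z * cabs2 w.
Proof. by apply: cRI; rewrite cRM !cabs2E cconjM mulrACA. Qed.

Lemma cabs2_cR r : cabs2 (cR r) = r ^+ 2.
Proof. by rewrite /cabs2 /cR expr0n addr0. Qed.

Lemma cabs2_cconj z : cabs2 (cconj z) = cabs2 z.
Proof. by apply: cRI; rewrite !cabs2E cconjK mulrC. Qed.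

Lemma cabs2_eq0 z : (cabs2 z == 0) = (z == 0).
Proof.
by case: z => a b; rewrite /cabs2 eq_complex paddr_eq0 ?sqr_ge0 // !sqrf_eq0.
Qed.

Lemma cabs2_0 : cabs2 (0 : R[i]) = 0.
Proof. by apply/eqP; rewrite cabs2_eq0. Qed.

Lemma cabs_ge0 z : 0 <= cabs z.
Proof. exact: sqrtr_ge0. Qed.

Lemma sqr_cabs z : cabs z ^+ 2 = cabs2 z.
Proof. by rewrite sqr_sqrtr // cabs2_ge0. Qed.

Lemma cabsM z w : cabs (z * w) = cabs z * cabs w.
Proof. by rewrite /cabs cabs2M sqrtrM // cabs2_ge0. Qed.

Lemma cabs_cR r : cabs (cR r) = `|r|.
Proof. by rewrite /cabs cabs2_cR sqrtr_sqr. Qed.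

Lemma cabs0 : cabs (0 : R[i]) = 0.
Proof. by rewrite /cabs cabs2_0 sqrtr0. Qed.

Lemma cabsD z w : cabs (z + w) <= cabs z + cabs w.
Proof.
have E (x : R[i]) : cabs x = complex.ComplexField.Normc.normc x by case: x.
by rewrite !E; exact: complex.le_normcD.
Qed.

Lemma cabs_sum (I : finType) (f : I -> R[i]) :
  cabs (\sum_i f i) <= \sum_i cabs (f i).
Proof.
elim/big_ind2: _ => // [|x1 x2 y1 y2 h1 h2]; first by rewrite cabs0.
exact: le_trans (cabsD _ _) (lerD h1 h2).
Qed.

End ComplexModulus.

(** * Cauchy-Schwarz and the unweighted square norm *)

Section CauchySchwarz.
Context {R : realType}.

Lemma cauchy_schwarz_sqr (I : finType) (a b : I -> R) :
  (\sum_i a i * b i) ^+ 2 <= (\sum_i a i ^+ 2) * (\sum_i b i ^+ 2).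
Proof.
(* Lagrange's identity: this double sum is twice the defect of the inequality. *)
have H : 0 <= \sum_i \sum_j (a i * b j - a j * b i) ^+ 2.
  by apply: sumr_ge0 => i _; apply: sumr_ge0 => j _; apply: sqr_ge0.
have E : \sum_i \sum_j (a i * b j - a j * b i) ^+ 2 =
  2 * ((\sum_i a i ^+ 2) * (\sum_i b i ^+ 2)) - 2 * (\sum_i a i * b i) ^+ 2.
  have P (c d : I -> R) : \sum_i \sum_j c i * d j = (\sum_i c i) * (\sum_i d i).
    by rewrite mulr_suml; apply: eq_bigr => i _; rewrite mulr_sumr.
  transitivity (\sum_i \sum_j (a i ^+ 2 * b j ^+ 2) +
    \sum_i \sum_j (b i ^+ 2 * a j ^+ 2) -
    \sum_i \sum_j (2 * (a i * b i)) * (a j * b j)).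
    rewrite -big_split -sumrB; apply: eq_bigr => i _ /=.
    by rewrite -big_split -sumrB; apply: eq_bigr => j _ /=; ring.
  by rewrite !P -mulr_sumr; ring.
by move: H; rewrite E; lra.
Qed.

Lemma cauchy_schwarz (I : finType) (a b : I -> R) :
  \sum_i a i * b i <= Num.sqrt (\sum_i a i ^+ 2) * Num.sqrt (\sum_i b i ^+ 2).
Proof.
have A : 0 <= \sum_i a i ^+ 2 by apply: sumr_ge0 => i _; apply: sqr_ge0.
rewrite -sqrtrM //; apply: le_trans (ler_norm _) _.
by rewrite -sqrtr_sqr; apply: ler_wsqrtr; apply: cauchy_schwarz_sqr.
Qed.

(** Counting measure: a weight [p] enters later through multiplication by [sqrt p], so all operators
    act on plain l2. *)
Definition nsq {I : finType} (f : I -> R[i]) : R := \sum_i cabs2 (f i).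

Lemma nsq_ge0 (I : finType) (f : I -> R[i]) : 0 <= nsq f.
Proof. by apply: sumr_ge0 => i _; apply: cabs2_ge0. Qed.

Lemma nsqE (I : finType) (f : I -> R[i]) :
  cR (nsq f) = \sum_i cconj (f i) * f i.
Proof. by rewrite cR_sum; apply: eq_bigr => i _; rewrite cabs2E. Qed.

Lemma nsq_eq0 (I : finType) (f : I -> R[i]) : nsq f = 0 -> forall i, f i = 0.
Proof.
move=> /eqP; rewrite psumr_eq0; last by move=> i _; apply: cabs2_ge0.
by move=> /allP H i; apply/eqP; rewrite -cabs2_eq0; apply: H; rewrite mem_index_enum.
Qed.

Lemma nsqZ (I : finType) (c : R[i]) (f : I -> R[i]) :
  nsq (fun i => c * f i) = cabs2 c * nsq f.
Proof. by rewrite /nsq mulr_sumr; apply: eq_bigr => i _; rewrite cabs2M. Qed.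

Lemma nsq_cconj (I : finType) (f : I -> R[i]) :
  nsq (fun i => cconj (f i)) = nsq f.
Proof. by apply: eq_bigr => i _; rewrite cabs2_cconj. Qed.

Lemma cabs_inner_le (I : finType) (f g : I -> R[i]) :
  cabs (\sum_i f i * g i) <= Num.sqrt (nsq f) * Num.sqrt (nsq g).
Proof.
apply: le_trans (cabs_sum _) _.
under eq_bigr => i _ do rewrite cabsM.
apply: le_trans (cauchy_schwarz _ _) _.
by under eq_bigr => i _ do rewrite sqr_cabs; under [X in _ * Num.sqrt X <= _]eq_bigr => i _ do rewrite sqr_cabs.
Qed.

End CauchySchwarz.

(** * The polarization frame *)

Section Frame.
Context {R : realType}.
Local Notation C := R[i].

Definition om (j : 'I_4) : C := Complex 0 1 ^+ j.

(* Coefficients against the frame vectors e_y + i^j e_y'.  All ordered pairs are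
   used, y = y' included: summing over j then kills every cross term, so the frame
   is tight with constant 8 |Y|. *)
Definition pol {Y : Type} (b : Y -> C) (k : Y * Y * 'I_4) : C :=
  b k.1.1 + om k.2 * b k.1.2.
Definition polc {Y : Type} (b : Y -> C) (k : Y * Y * 'I_4) : C :=
  b k.1.1 + cconj (om k.2) * b k.1.2.

Lemma sum_om (P : C -> C) :
  \sum_j P (om j) = P 1 + P (Complex 0 1) + P (-1) + P (- Complex 0 1).
Proof.
have i2 : Complex 0 1 * Complex 0 1 = -1 :> C by rewrite -expr2 sqr_i.
rewrite !big_ord_recl big_ord0 /om /= /bump /= addr0 !addrA.
by rewrite expr0 expr1 addn1 expr2 exprS expr2 i2 mulrN1.
Qed.

Lemma cconj_i : cconj (Complex 0 1) = - Complex 0 1 :> C.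
Proof. by apply/eqP; rewrite eq_complex /= oppr0 !eqxx. Qed.

Lemma cabs2_om j : cabs2 (om j) = 1.
Proof.
have: cabs2 (Complex 0 1 : C) = 1 by rewrite /cabs2 expr0n expr1n add0r.
rewrite /om => H; elim: (nat_of_ord j) => [|m IH].
  by rewrite expr0 -[1]/(cR 1) cabs2_cR expr1n.
by rewrite exprS cabs2M H IH mulr1.
Qed.

Lemma cabs_om j : cabs (om j) = 1.
Proof. by rewrite /cabs cabs2_om sqrtr1. Qed.

(** In [|A + om B|^2] only [A * cconj B] carries [cconj om], which the weight [om] cancels; the
    other terms end up with [om] or its square and sum to zero. *)
Lemma polarization (A B : C) :
  \sum_j om j * cR (cabs2 (A + om j * B)) = 4 * (A * cconj B).
Proof.
rewrite (sum_om (fun o => o * cR (cabs2 (A + o * B)))) !cabs2E.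
rewrite !cconjD !cconjM !cconjN !cconj1 !cconj_i.
have i2 : Complex 0 1 * Complex 0 1 = -1 :> C by rewrite -expr2 sqr_i.
move: (cconj A) (cconj B) i2 => a b; move: (Complex 0 1) => i i2.
have -> : i * ((a + - i * b) * (A + i * B)) =
   i * a * A + (i * i) * (a * B) - (i * i) * b * A  - (i * i) * i * b * B by ring.
have -> : - i * ((a + - - i * b) * (A + - i * B)) =
   - i * a * A + (i * i) * (a * B) - (i * i) * b * A  + (i * i) * i * b * B by ring.
by rewrite i2; ring.
Qed.

Lemma polarization_conj (A B : C) :
  \sum_j om j * cR (cabs2 (A + cconj (om j) * B)) = 4 * (cconj A * B).
Proof.
rewrite -[B in RHS]cconjK -polarization; apply: eq_bigr => j _.
by rewrite -cabs2_cconj cconjD cconjM cconjK.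
Qed.

Lemma sum_frame (Y : finType) (V : nmodType) (P : Y -> Y -> 'I_4 -> V) :
  \sum_(k : Y * Y * 'I_4) P k.1.1 k.1.2 k.2 = \sum_y \sum_y' \sum_j P y y' j.
Proof.
rewrite pair_bigA /= pair_bigA /=; apply: eq_bigr => k _ //.
Qed.

(** Resolution of the identity: the cross terms carry a root or its conjugate and cancel over [j].
    The pairing is bilinear, hence the conjugated roots in [polc]. *)
Lemma pol_resolution (Y : finType) (a b : Y -> C) :
  \sum_k polc a k * pol b k = (8 * #|Y|)%:R * \sum_y a y * b y.
Proof.
rewrite (sum_frame (fun y y' j => (a y + cconj (om j) * a y') * (b y + om j * b y'))).
have E y y' : \sum_j (a y + cconj (om j) * a y') * (b y + om j * b y') =
  4 * (a y * b y) + 4 * (a y' * b y').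
  rewrite (sum_om (fun o => (a y + cconj o * a y') * (b y + o * b y'))).
  rewrite !cconjN cconj1 !cconj_i.
  have i2 : Complex 0 1 * Complex 0 1 = -1 :> C by rewrite -expr2 sqr_i.
  move: (Complex 0 1) i2 => i i2.
  have -> : (a y + - i * a y') * (b y + i * b y') =
     a y * b y + i * (a y * b y' - a y' * b y) - (i * i) * a y' * b y' by ring.
  have -> : (a y + - - i * a y') * (b y + - i * b y') =
     a y * b y - i * (a y * b y' - a y' * b y) - (i * i) * a y' * b y' by ring.
  by rewrite i2; ring.
under eq_bigr => y _ do under eq_bigr => y' _ do rewrite E.
under eq_bigr => y _ do rewrite big_split /= sumr_const.
rewrite big_split /= sumr_const sumrMnl -!mulr_sumr -[4 * _ *+ _]mulr_natr natrM.
by ring.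
Qed.

Lemma polc_cconj (Y : finType) (b : Y -> C) k :
  polc (fun y => cconj (b y)) k = cconj (pol b k).
Proof. by rewrite /polc /pol cconjD cconjM. Qed.

Lemma nsq_pol (Y : finType) (b : Y -> C) :
  \sum_k cabs2 (pol b k) = (8 * #|Y|)%:R * nsq b.
Proof.
apply: cRI; rewrite cR_sum cRM cR_nat nsqE -pol_resolution.
by apply: eq_bigr => k _; rewrite cabs2E polc_cconj.
Qed.

Lemma nsq_polc (Y : finType) (b : Y -> C) :
  \sum_k cabs2 (polc b k) = (8 * #|Y|)%:R * nsq b.
Proof.
rewrite -nsq_cconj -nsq_pol; apply: eq_bigr => k _.
by rewrite -cabs2_cconj; congr cabs2; rewrite /pol /polc cconjD cconjM cconjK.
Qed.

(** Coefficients in the product frame. [polc] is used in both factors because [F] is paired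
    bilinearly with [pol g] and [pol h]. *)
Definition pol2 {Y Z : Type} (F : Y * Z -> C) (k : Y * Y * 'I_4) (l : Z * Z * 'I_4) : C :=
  polc (fun y => polc (fun z => F (y, z)) l) k.

Lemma pol2_resolution (Y Z : finType) (F : Y * Z -> C) (g : Y -> C) (h : Z -> C) :
  \sum_k \sum_l pol2 F k l * (pol g k * pol h l) =
  (64 * #|Y| * #|Z|)%:R * \sum_t F t * (g t.1 * h t.2).
Proof.
rewrite exchange_big /=.
transitivity (\sum_l (8 * #|Y|)%:R * (\sum_y polc (fun z => F (y, z)) l * g y * pol h l)).
  apply: eq_bigr => l _; under eq_bigr => k _ do rewrite mulrA.
  by rewrite -!mulr_suml /pol2 pol_resolution mulrA.
rewrite -mulr_sumr exchange_big /=.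
transitivity ((8 * #|Y|)%:R * (\sum_y (8 * #|Z|)%:R * \sum_z F (y, z) * (g y * h z)) : C).
  congr (_ * _); apply: eq_bigr => y _.
  under eq_bigr => l _ do rewrite [_ * g y]mulrC -mulrA.
  rewrite -mulr_sumr pol_resolution mulrCA; congr (_ * _).
  by rewrite mulr_sumr; apply: eq_bigr => z _; ring.
rewrite -mulr_sumr mulrA -natrM pair_bigA /=; congr (_%:R * _).
  by rewrite mulnACA mulnA.
by apply: eq_bigr => -[].
Qed.

Lemma nsq_pol2 (Y Z : finType) (F : Y * Z -> C) :
  \sum_k \sum_l cabs2 (pol2 F k l) = (64 * #|Y| * #|Z|)%:R * nsq F.
Proof.
rewrite exchange_big /=.
under eq_bigr => l _ do rewrite /pol2 nsq_polc.
rewrite -mulr_sumr exchange_big /=.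
under eq_bigr => y _ do rewrite nsq_polc.
rewrite -mulr_sumr mulrA -natrM pair_bigA /=; congr (_%:R * _).
  by rewrite mulnACA mulnA.
by apply: eq_bigr => -[].
Qed.

(** Polarizing in one tensor factor turns the square into a product of two different vectors; this
    form handles the remaining factor. *)
Lemma polarization_cross (a a' b b' : C) :
  \sum_j om j * (cconj (a + cconj (om j) * a') * (b + cconj (om j) * b')) =
  4 * (cconj a * b').
Proof.
rewrite (sum_om (fun o => o * (cconj (a + cconj o * a') * (b + cconj o * b')))).
rewrite !cconjD !cconjM !cconjK !cconjN !cconj1 !cconj_i.
have i2 : Complex 0 1 * Complex 0 1 = -1 :> C by rewrite -expr2 sqr_i.
move: (cconj a) (cconj a') (Complex 0 1) i2 => {}a {}a' i i2.
have -> : i * ((a + i * a') * (b + - i * b')) =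
  i * a * b - (i * i) * (a * b') + (i * i) * (a' * b) - (i * i) * i * (a' * b') by ring.
have -> : - i * ((a + - i * a') * (b + - - i * b')) =
  - i * a * b - (i * i) * (a * b') + (i * i) * (a' * b) + (i * i) * i * (a' * b') by ring.
by rewrite i2; ring.
Qed.

(** Informational completeness of the product frame: the squared coefficients determine every entry
    of the density matrix of [F]. *)
Lemma polarization2 (Y Z : finType) (F : Y * Z -> C) y y' z z' :
  \sum_j \sum_j' om j * om j' * cR (cabs2 (pol2 F (y, y', j) (z, z', j'))) =
  16 * (cconj (F (y, z)) * F (y', z')).
Proof.
rewrite exchange_big /=.
transitivity (\sum_j' 4 * (om j' * (cconj (F (y, z) + cconj (om j') * F (y, z')) *
                (F (y', z) + cconj (om j') * F (y', z'))))).
  apply: eq_bigr => j' _; rewrite mulrCA -polarization_conj mulr_sumr.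
  by apply: eq_bigr => j _; rewrite [om j * om j']mulrC mulrA.
by rewrite -mulr_sumr polarization_cross; ring.
Qed.

End Frame.

(** * Outcome distributions determine the state *)

Section Tomography.
Context {R : realType} {Y Z V U W : finType}.
Local Notation C := R[i].
Variables (F : Y * Z -> V -> C) (g : Y -> U -> C) (h : Z -> W -> C).

(** Unnormalized probability of the outcome [(k, l)] for the mixed state purified by [F]; [V] is the
    auxiliary space traced out. *)
Definition outcome2 k l : R := nsq (fun v => pol2 (F^~ v) k l).
Definition outcome {Y U : finType} (g : Y -> U -> C) k : R := nsq (fun u => pol (g^~ u) k).

Lemma outcome2_ge0 k l : 0 <= outcome2 k l. Proof. exact: nsq_ge0. Qed.
Lemma outcome_ge0 {Y' U' : finType} (g' : Y' -> U' -> C) k : 0 <= outcome g' k.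
Proof. exact: nsq_ge0. Qed.

Definition nsq2 {I J : finType} (f : I -> J -> C) : R := \sum_i nsq (f i).

Lemma nsq2_ge0 (I J : finType) (f : I -> J -> C) : 0 <= nsq2 f.
Proof. by apply: sumr_ge0 => i _; apply: nsq_ge0. Qed.

Lemma nsq2_exchange (I J : finType) (f : I -> J -> C) :
  \sum_j nsq (f^~ j) = nsq2 f.
Proof. by rewrite /nsq2 /nsq exchange_big. Qed.

Lemma sum_outcome2 : \sum_k \sum_l outcome2 k l = (64 * #|Y| * #|Z|)%:R * nsq2 F.
Proof.
rewrite -nsq2_exchange mulr_sumr.
under [RHS]eq_bigr => v _ do rewrite -nsq_pol2.
rewrite [RHS]exchange_big; apply: eq_bigr => k _.
by rewrite [RHS]exchange_big.
Qed.

Lemma sum_outcome {Y' U' : finType} (g' : Y' -> U' -> C) :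
  \sum_k outcome g' k = (8 * #|Y'|)%:R * nsq2 g'.
Proof.
rewrite -nsq2_exchange mulr_sumr.
under [RHS]eq_bigr => v _ do rewrite -nsq_pol.
by rewrite exchange_big.
Qed.

Lemma sum_outcome_prod : \sum_k \sum_l outcome g k * outcome h l =
  (64 * #|Y| * #|Z|)%:R * (nsq2 g * nsq2 h).
Proof.
under eq_bigr => k _ do rewrite -mulr_sumr sum_outcome.
rewrite -mulr_suml sum_outcome !natrM; ring.
Qed.

(* Matrix entries of (state of F) - (product state of conj g, conj h). *)
Definition gap (t t' : Y * Z) : C :=
  (\sum_v cconj (F t v) * F t' v) -
  (\sum_u g t.1 u * cconj (g t'.1 u)) * (\sum_w h t.2 w * cconj (h t'.2 w)).

Lemma outcome_polarization {Y' U' : finType} (g' : Y' -> U' -> C) y y' :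
  \sum_j om j * cR (outcome g' (y, y', j)) = 4 * \sum_u g' y u * cconj (g' y' u).
Proof.
rewrite mulr_sumr; under [RHS]eq_bigr => u _ do rewrite -polarization.
rewrite exchange_big; apply: eq_bigr => j _ /=.
by rewrite cR_sum mulr_sumr.
Qed.

Lemma gap_polarization y y' z z' :
  16 * gap (y, z) (y', z') = \sum_j \sum_j' om j * om j' *
    cR (outcome2 (y, y', j) (z, z', j') - outcome g (y, y', j) * outcome h (z, z', j')).
Proof.
rewrite /gap mulrBr /=; symmetry.
transitivity (\sum_j \sum_j' om j * om j' * cR (outcome2 (y, y', j) (z, z', j')) -
  (\sum_j om j * cR (outcome g (y, y', j))) * (\sum_j' om j' * cR (outcome h (z, z', j')))).
  rewrite mulr_suml -sumrB; apply: eq_bigr => j _.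
  rewrite mulr_sumr -sumrB; apply: eq_bigr => j' _.
  by rewrite cRB cRM; ring.
rewrite !outcome_polarization; congr (_ - _); last by ring.
rewrite mulr_sumr; under [RHS]eq_bigr => v _ do rewrite -(polarization2 (F^~ v)).
rewrite [RHS]exchange_big; apply: eq_bigr => j _.
rewrite [RHS]exchange_big; apply: eq_bigr => j' _.
by rewrite cR_sum mulr_sumr.
Qed.

(** Polarization writes each entry of [gap] through differences of outcome weights with unimodular
    coefficients, and each pair of frame indices is met exactly once. *)
Lemma gap_le : 16 * (\sum_t \sum_t' cabs (gap t t')) <=
  \sum_k \sum_l `|outcome2 k l - outcome g k * outcome h l|.
Proof.
pose d k l := `|outcome2 k l - outcome g k * outcome h l|.
have E : \sum_k \sum_l d k l =
    \sum_(t : Y * Z) \sum_(t' : Y * Z) \sum_j \sum_j' d (t.1, t'.1, j) (t.2, t'.2, j').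
  transitivity (\sum_y \sum_y' \sum_j \sum_z \sum_z' \sum_j' d (y, y', j) (z, z', j')).
    rewrite -(sum_frame (fun y y' j => \sum_z \sum_z' \sum_j' d (y, y', j) (z, z', j'))).
    apply: eq_bigr => -[[y y'] j] _ /=.
    rewrite -(sum_frame (fun z z' j' => d (y, y', j) (z, z', j'))).
    by apply: eq_bigr => -[[z z'] j'].
  rewrite -(pair_bigA _ (fun y z => \sum_t' \sum_j \sum_j'
     d (y, t'.1, j) (z, t'.2, j'))) /=.
  apply: eq_bigr => y _.
  under [RHS]eq_bigr => z _ do rewrite -(pair_bigA _ (fun y' z' => \sum_j \sum_j'
     d (y, y', j) (z, z', j'))) /=.
  rewrite [RHS]exchange_big; apply: eq_bigr => y' _ /=.
  rewrite exchange_big; apply: eq_bigr => z _ /=.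
  by rewrite exchange_big.
rewrite -/d E mulr_sumr; apply: ler_sum => -[y z] _.
rewrite mulr_sumr; apply: ler_sum => -[y' z'] _ /=.
have -> : 16 * cabs (gap (y, z) (y', z')) = cabs (16 * gap (y, z) (y', z')).
  by rewrite cabsM -(cR_nat 16) cabs_cR ger0_norm.
rewrite gap_polarization; apply: le_trans (cabs_sum _) _.
apply: ler_sum => j _; apply: le_trans (cabs_sum _) _.
by apply: ler_sum => j' _; rewrite !cabsM !cabs_om !mul1r cabs_cR.
Qed.

End Tomography.

(** * The vector-valued one-coordinate bound *)

Section OneStep.
Context {R : realType}.
Local Notation C := R[i].

(** The larger of [t] and [t1] dominates alone. A term linear in [t] is thus traded for a power of
    [t], at a cost depending only on [t1]. *)
Lemma tradeoff (t t1 : R) k : 0 <= t -> 0 <= t1 -> t1 ^+ k * t <= t ^+ k.+1 + t1 ^+ k.+1.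
Proof.
move=> t0 t10; rewrite !exprSr; have [h|h] := leP t t1.
  rewrite -[leLHS]add0r; apply: lerD; first by rewrite mulr_ge0 // exprn_ge0.
  by rewrite ler_wpM2l // exprn_ge0.
rewrite -[leLHS]addr0; apply: lerD; last by rewrite mulr_ge0 // exprn_ge0.
by rewrite ler_wpM2r // lerXn2r ?nnegrE // ltW.
Qed.

(** The witness is at least [1 + 2 kap - 3 dl] on [A f] (values [a1], [a2]) and at most [1 + kap] on
    the product state (values [b1], [b2]); the distance terms [k1], [k2] must pay for the
    difference. *)
Lemma witness_arith (a1 a2 b1 b2 k1 k2 eta tau kap dl : R) :
  0 <= dl -> 0 <= eta -> eta <= 1 -> eta * tau = 4 * kap ->
  1 - 2 * dl <= a1 -> tau <= 2 * a2 + 2 * dl -> b1 + eta * b2 <= 1 + kap ->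
  a1 - b1 <= k1 -> a2 - b2 <= k2 -> 0 <= k2 -> kap <= 3 * dl + (k1 + k2).
Proof.
move=> dl0 eta0 eta1 kapE E1 E2 prodW W1 W2 k20.
have := ler_wpM2l eta0 E2; have := ler_wpM2l eta0 W2.
have : eta * k2 <= k2 by rewrite -[leRHS]mul1r ler_wpM2r.
have : eta * dl <= dl by rewrite -[leRHS]mul1r ler_wpM2r.
by lra.
Qed.

(** Factor [m - r] as a difference of squares of roots and apply Cauchy-Schwarz; the two sums of
    squares are the total mass minus and plus twice the Bhattacharyya coefficient. *)
Lemma hellinger_le (I : finType) (m r : I -> R) :
  (forall i, 0 <= m i) -> (forall i, 0 <= r i) ->
  (\sum_i `|m i - r i|) ^+ 2 <=
  (\sum_i m i + \sum_i r i) ^+ 2 - (2 * \sum_i Num.sqrt (m i) * Num.sqrt (r i)) ^+ 2.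
Proof.
move=> m0 r0.
pose a i : R := `|Num.sqrt (m i) - Num.sqrt (r i)|; pose b i := Num.sqrt (m i) + Num.sqrt (r i).
have E i : `|m i - r i| = a i * b i.
  rewrite -{1}(sqr_sqrtr (m0 i)) -{1}(sqr_sqrtr (r0 i)) subr_sqr normrM.
  by rewrite [X in _ * X]ger0_norm // addr_ge0 ?sqrtr_ge0.
under eq_bigr => i _ do rewrite E.
apply: le_trans (cauchy_schwarz_sqr _ _) _.
have sm i : m i = Num.sqrt (m i) ^+ 2 by rewrite sqr_sqrtr.
have sr i : r i = Num.sqrt (r i) ^+ 2 by rewrite sqr_sqrtr.
have Ea : \sum_i a i ^+ 2 =
    \sum_i m i + \sum_i r i - 2 * \sum_i Num.sqrt (m i) * Num.sqrt (r i).
  rewrite mulr_sumr -big_split -sumrB /=; apply: eq_bigr => i _.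
  rewrite /a real_normK ?num_real // [in m i + _]sm [in _ + r i]sr; ring.
have Eb : \sum_i b i ^+ 2 =
    \sum_i m i + \sum_i r i + 2 * \sum_i Num.sqrt (m i) * Num.sqrt (r i).
  rewrite mulr_sumr -!big_split /=; apply: eq_bigr => i _.
  rewrite /b [in m i + _]sm [in _ + r i]sr; ring.
by rewrite Ea Eb subr_sqr.
Qed.

Definition lin {I J : finType} (L : I -> J -> C) (phi : J -> C) (x : I) : C :=
  \sum_t L x t * phi t.

Definition gram {I J : finType} (L : I -> J -> C) (t t' : J) : C :=
  \sum_x cconj (L x t) * L x t'.

Lemma nsq_lin (I J : finType) (L : I -> J -> C) phi :
  cR (nsq (lin L phi)) = \sum_t \sum_t' gram L t t' * (cconj (phi t) * phi t').
Proof.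
rewrite nsqE.
transitivity (\sum_x \sum_t \sum_t' (cconj (L x t) * L x t') * (cconj (phi t) * phi t')).
  apply: eq_bigr => x _; rewrite /lin cconj_sum mulr_suml; apply: eq_bigr => t _.
  by rewrite mulr_sumr; apply: eq_bigr => t' _; rewrite cconjM; ring.
rewrite exchange_big; apply: eq_bigr => t _ /=.
rewrite exchange_big; apply: eq_bigr => t' _ /=.
by rewrite mulr_suml.
Qed.

(** Both terms are linear in the state, so the left side is the pairing of [gram L] with [gap],
    bounded crudely by the product of the two entrywise l1 norms. *)
Lemma witness_gap (X Y Z V U W : finType) (L : X -> Y * Z -> C)
    (F : Y * Z -> V -> C) (g : Y -> U -> C) (h : Z -> W -> C) :
  \sum_v nsq (lin L (F^~ v)) -
  \sum_u \sum_w nsq (lin L (fun t => cconj (g t.1 u * h t.2 w))) <=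
  (\sum_t \sum_t' cabs (gram L t t')) * \sum_t \sum_t' cabs (gap F g h t t').
Proof.
set D := _ - _.
have E : cR D = \sum_t \sum_t' gram L t t' * gap F g h t t'.
  rewrite /D cRB !cR_sum.
  under eq_bigr => v _ do rewrite nsq_lin.
  under [X in _ - X]eq_bigr => u _ do rewrite cR_sum.
  under [X in _ - X]eq_bigr => u _ do under eq_bigr => w _ do rewrite nsq_lin.
  rewrite exchange_big /=.
  under [X in _ - X]eq_bigr => u _ do rewrite exchange_big /=.
  rewrite [X in _ - X]exchange_big -sumrB; apply: eq_bigr => t _ /=.
  rewrite exchange_big /=.
  under [X in _ - X]eq_bigr => u _ do rewrite exchange_big /=.
  rewrite [X in _ - X]exchange_big -sumrB; apply: eq_bigr => t' _ /=.
  rewrite /gap mulrBr; congr (_ - _); first by rewrite mulr_sumr.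
  rewrite mulr_suml mulr_sumr; apply: eq_bigr => u _.
  rewrite !mulr_sumr; apply: eq_bigr => w _.
  by rewrite cconjK cconjM; ring.
have -> : (\sum_t \sum_t' cabs (gram L t t')) * \sum_t \sum_t' cabs (gap F g h t t') =
   (\sum_p cabs (gram L p.1 p.2)) * \sum_p cabs (gap F g h p.1 p.2) by rewrite !pair_bigA.
apply: le_trans (ler_norm D) _; rewrite -cabs_cR E pair_bigA /=.
apply: le_trans (cabs_sum _) _.
rewrite mulr_suml; apply: ler_sum => p _; rewrite cabsM ler_wpM2l ?cabs_ge0 //.
rewrite (bigD1 p) //= lerDl; apply: sumr_ge0 => q _; exact: cabs_ge0.
Qed.

(** * The contraction A with kernel [K], and its witness *)

Variables (X Y Z : finType) (K : X -> Y * Z -> C) (s : X -> R) (Q : X -> X -> C).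
Variables (c1 : R) (C' : nat).

Definition triform (f : X -> C) (g : Y -> C) (h : Z -> C) : C :=
  \sum_x \sum_t K x t * f x * (g t.1 * h t.2).

Hypothesis gramK : forall x x', \sum_t cconj (K x t) * K x' t = if x == x' then cR (s x) else 0.
Hypothesis s01 : forall x, 0 <= s x <= 1.
Hypothesis Q_contr : forall f, nsq (lin Q f) <= nsq f.
Hypothesis c1_01 : 0 < c1 <= 1.
Hypothesis base : forall f g h t, 0 <= t -> t * nsq f <= nsq (lin Q f) ->
  cabs (triform f g h) <=
  (1 - c1 * t ^+ C'.+1) * Num.sqrt (nsq f) * Num.sqrt (nsq g) * Num.sqrt (nsq h).

Definition Kadj (x : X) (t : Y * Z) : C := cconj (K x t).
(* The witness is A (1 + eta Q) A^*; its quadratic form at phi is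
   |Kadj phi|^2 + eta |QKadj phi|^2. *)
Definition QKadj (x : X) (t : Y * Z) : C := \sum_x' Q x x' * cconj (K x' t).

Lemma lin_QKadj phi x : lin QKadj phi x = lin Q (lin Kadj phi) x.
Proof.
rewrite /lin /QKadj.
under eq_bigr => t _ do rewrite mulr_suml.
rewrite exchange_big; apply: eq_bigr => x' _ /=.
by rewrite mulr_sumr; apply: eq_bigr => t _; rewrite mulrA.
Qed.

(* Test the base case on f = u := A^* (conj (g h)), for which the form equals |u|^2. *)
Lemma product_witness (g : Y -> C) (h : Z -> C) (t1 : R) : 0 <= t1 ->
  nsq (lin Kadj (fun t => cconj (g t.1 * h t.2))) +
  c1 * t1 ^+ C' * nsq (lin QKadj (fun t => cconj (g t.1 * h t.2))) <=
  (1 + c1 * t1 ^+ C'.+1) * (nsq g * nsq h).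
Proof.
move=> t10; case/andP: c1_01 => c10 c11.
set phi := fun t => _; set u := lin Kadj phi.
have -> : nsq (lin QKadj phi) = nsq (lin Q u) by apply: eq_bigr => x _; rewrite lin_QKadj.
have a0 := nsq_ge0 u; have b0 := nsq_ge0 (lin Q u); have ba := Q_contr u.
have G0 : 0 <= nsq g * nsq h by rewrite mulr_ge0 ?nsq_ge0.
have e0 : 0 <= c1 * t1 ^+ C' by rewrite mulr_ge0 ?exprn_ge0 // ltW.
have k0 : 0 <= c1 * t1 ^+ C'.+1 by rewrite mulr_ge0 ?exprn_ge0 // ltW.
have [az|an] := eqVneq (nsq u) 0.
  have -> : nsq (lin Q u) = 0 by apply/eqP; rewrite eq_le b0 andbT -az.
  by rewrite az mulr0 addr0 mulr_ge0 // addr_ge0.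
have ap : 0 < nsq u by rewrite lt_neqAle eq_sym an.
(* The share of [u] that survives [Q], which is the largest parameter at which the base case applies
   to [u]. *)
pose t := nsq (lin Q u) / nsq u.
have t0 : 0 <= t by rewrite divr_ge0.
have t1' : t <= 1 by rewrite ler_pdivrMr // mul1r.
have bE : nsq (lin Q u) = t * nsq u by rewrite /t mulfVK.
have fE : triform u g h = cR (nsq u).
  rewrite nsqE; apply: eq_bigr => x _.
  transitivity (u x * \sum_t0 K x t0 * (g t0.1 * h t0.2)).
    by rewrite mulr_sumr; apply: eq_bigr => t' _; ring.
  rewrite mulrC; congr (_ * _).
  rewrite /u /lin cconj_sum; apply: eq_bigr => t' _.
  by rewrite /Kadj /phi -cconjM cconjK.
have := @base u g h t t0; rewrite bE fE cabs_cR ger0_norm // => /(_ (lexx _)).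
rewrite -mulrA -(sqrtrM _ (nsq_ge0 g)).
set q := 1 - _; set G := nsq g * nsq h in G0 *; move=> H.
have tC : 0 <= t ^+ C'.+1 <= 1 by rewrite exprn_ge0 //= exprn_ile1.
have cc : 0 <= c1 * t ^+ C'.+1 <= 1.
  case/andP: tC => ? ?; rewrite mulr_ge0 //=; last exact: ltW.
  by rewrite mulr_ile1 // ltW.
have q0 : 0 <= q by rewrite /q; lra.
have q1 : q <= 1 by rewrite /q; lra.
have su0 : 0 < Num.sqrt (nsq u) by rewrite sqrtr_gt0.
have H1 : Num.sqrt (nsq u) <= q * Num.sqrt G.
  rewrite -(ler_pM2l su0) -expr2 sqr_sqrtr //; apply: le_trans H _.
  by rewrite [q * Num.sqrt (nsq u)]mulrC -mulrA.
have H2 : nsq u <= q * G.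
  rewrite -[leLHS]sqr_sqrtr //; apply: (@le_trans _ _ ((q * Num.sqrt G) ^+ 2)).
    by rewrite lerXn2r ?nnegrE // ?mulr_ge0 ?sqrtr_ge0.
  rewrite exprMn sqr_sqrtr // ler_wpM2r // expr2 -[leRHS]mulr1 ler_wpM2l //.
have -> : nsq u + c1 * t1 ^+ C' * (t * nsq u) = (1 + c1 * t1 ^+ C' * t) * nsq u by ring.
have p0 : 0 <= 1 + c1 * t1 ^+ C' * t by rewrite addr_ge0 // mulr_ge0.
apply: le_trans (ler_wpM2l p0 H2) _; rewrite mulrA ler_wpM2r //.
(* What remains is [(1 + c1 t1^C' t)(1 - c1 t^(C'+1)) <= 1 + c1 t1^(C'+1)]: drop the negative cross
   term and trade the linear term. *)
have T : c1 * (t1 ^+ C' * t) <= c1 * (t ^+ C'.+1 + t1 ^+ C'.+1).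
  by rewrite ler_wpM2l ?tradeoff // ltW.
have : 0 <= (c1 * t1 ^+ C' * t) * (c1 * t ^+ C'.+1) .
  by apply: mulr_ge0; [rewrite mulr_ge0 | case/andP: cc].
rewrite /q; move: T; nra.
Qed.

Definition Kop (f : X -> C) (t : Y * Z) : C := \sum_x K x t * f x.

(** [Kop] is A, and the orthogonality of its columns makes [A^* A] multiplication by [s]. *)
Lemma Kadj_Kop f x : lin Kadj (Kop f) x = cR (s x) * f x.
Proof.
rewrite /lin /Kop; under eq_bigr => t _ do rewrite mulr_sumr.
rewrite exchange_big /= (bigD1 x) //= [X in _ + X]big1 ?addr0 => [|x' ne].
  rewrite -[in RHS](if_same (x == x) (cR (s x))); have := gramK x x; rewrite eqxx => <-.
  by rewrite mulr_suml; apply: eq_bigr => t _; rewrite mulrA.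
transitivity ((\sum_t cconj (K x t) * K x' t) * f x').
  by rewrite mulr_suml; apply: eq_bigr => t _; rewrite mulrA.
by rewrite gramK eq_sym (negbTE ne) mul0r.
Qed.

Lemma nsq_Kop f : nsq (Kop f) = \sum_x s x * cabs2 (f x).
Proof.
apply: cRI; rewrite nsqE cR_sum.
transitivity (\sum_t \sum_x cconj (f x) * (cconj (K x t) * Kop f t)).
  apply: eq_bigr => t _; rewrite /Kop cconj_sum mulr_suml.
  by apply: eq_bigr => x _; rewrite cconjM; ring.
rewrite exchange_big; apply: eq_bigr => x _ /=.
by rewrite -mulr_sumr -/(lin Kadj (Kop f) x) Kadj_Kop cRM cabs2E; ring.
Qed.

(** A is a contraction because [s <= 1]; then Cauchy-Schwarz against the product vector. *)
Lemma triform_le f g h :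
  cabs (triform f g h) <= Num.sqrt (nsq f) * Num.sqrt (nsq g) * Num.sqrt (nsq h).
Proof.
have -> : triform f g h = \sum_t Kop f t * (g t.1 * h t.2).
  by rewrite /triform exchange_big; apply: eq_bigr => t _; rewrite mulr_suml.
apply: le_trans (cabs_inner_le _ _) _.
have -> : nsq (fun t : Y * Z => g t.1 * h t.2) = nsq g * nsq h.
  rewrite /nsq mulr_suml.
  under [RHS]eq_bigr => y _ do rewrite mulr_sumr.
  by rewrite pair_bigA; apply: eq_bigr => t _; rewrite cabs2M.
rewrite sqrtrM ?nsq_ge0 // mulrA !ler_wpM2r ?sqrtr_ge0 // ler_wsqrtr //.
rewrite nsq_Kop; apply: ler_sum => x _; rewrite -[leRHS]mul1r.
by rewrite ler_wpM2r ?cabs2_ge0 //; case/andP: (s01 x).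
Qed.

Lemma cabs2D_le (z w : C) : cabs2 (z + w) <= 2 * cabs2 z + 2 * cabs2 w.
Proof.
case: z w => [a b] [c d]; rewrite /cabs2 /=.
have := sqr_ge0 (a - c); have := sqr_ge0 (b - d); nra.
Qed.

(** [A^* A] multiplies by [s], and [s^2 >= 2 s - 1]. *)
Lemma witness_Kop f :
  \sum_x cabs2 (f x) - 2 * (\sum_x cabs2 (f x) - \sum_x s x * cabs2 (f x)) <=
  nsq (lin Kadj (Kop f)).
Proof.
rewrite -sumrB mulr_sumr -sumrB; apply: ler_sum => x _.
rewrite Kadj_Kop cabs2M cabs2_cR.
have := cabs2_ge0 (f x); move: (cabs2 _) => a a0.
have : 0 <= (1 - s x) ^+ 2 * a by rewrite mulr_ge0 ?sqr_ge0.
by nra.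
Qed.

(** Split [f] into [s f] and [(1 - s) f]. The first part is what the witness sees; on the second [Q]
    is a contraction and [(1 - s)^2 <= 1 - s]. *)
Lemma Q_witness_Kop f :
  nsq (lin Q f) <= 2 * nsq (lin QKadj (Kop f)) +
    2 * (\sum_x cabs2 (f x) - \sum_x s x * cabs2 (f x)).
Proof.
pose fs x := cR (s x) * f x; pose fr x := cR (1 - s x) * f x.
have -> : nsq (lin QKadj (Kop f)) = nsq (lin Q fs).
  apply: eq_bigr => x _; rewrite lin_QKadj; congr cabs2.
  by apply: eq_bigr => x' _; rewrite Kadj_Kop.
have H : nsq (lin Q fr) <= \sum_x cabs2 (f x) - \sum_x s x * cabs2 (f x).
  apply: le_trans (Q_contr _) _; rewrite -sumrB; apply: ler_sum => x _.
  rewrite cabs2M cabs2_cR; have /andP[s0 s1] := s01 x.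
  have := cabs2_ge0 (f x); move: (cabs2 _) => a a0.
  have : 0 <= s x * (1 - s x) * a by rewrite !mulr_ge0 // subr_ge0.
  by nra.
apply: (@le_trans _ _ (2 * nsq (lin Q fs) + 2 * nsq (lin Q fr))); last by lra.
rewrite !mulr_sumr -big_split /=; apply: ler_sum => x _.
have -> : lin Q f x = lin Q fs x + lin Q fr x.
  rewrite /lin -big_split; apply: eq_bigr => x' _ /=.
  by rewrite /fs /fr -mulrDr -mulrDl -cRD addrC subrK mul1r.
exact: cabs2D_le.
Qed.

(** Tightness constant of the product frame: the total outcome weight of a unit vector. *)
Definition frame_size : R := (64 * #|Y| * #|Z|)%:R.
Definition gram_total : R :=
  \sum_t \sum_t' cabs (gram Kadj t t') + \sum_t \sum_t' cabs (gram QKadj t t').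
(** Obtained by solving [c1 (tau / 4)^(C'+1) <= L sqrt beta] for the deficit [beta], where [L] is
    [6 + gram_total * frame_size]. *)
Definition gain : R := c1 ^+ 2 / (16 ^+ C'.+1 * (6 + gram_total * frame_size) ^+ 2).

Lemma gram_total_ge0 : 0 <= gram_total.
Proof. by apply: addr_ge0; do 2 (apply: sumr_ge0 => ? _); apply: cabs_ge0. Qed.

Lemma gain_gt0 : 0 < gain.
Proof.
case/andP: c1_01 => c10 _; rewrite divr_gt0 ?exprn_gt0 // mulr_gt0 ?exprn_gt0 //.
by rewrite ltr_pwDl // mulr_ge0 ?gram_total_ge0 // /frame_size ler0n.
Qed.

Lemma gain_le1 : gain <= 1.
Proof.
case/andP: c1_01 => c10 c11.
have L1 : 1 <= 6 + gram_total * frame_size.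
  have : 0 <= gram_total * frame_size by rewrite mulr_ge0 ?gram_total_ge0 // /frame_size ler0n.
  by lra.
have D1 : 1 <= 16 ^+ C'.+1 * (6 + gram_total * frame_size) ^+ 2.
  rewrite -[leLHS]mulr1; apply: ler_pM => //; last by rewrite exprn_ege1.
  by rewrite exprn_ege1 // ler1n.
rewrite ler_pdivrMr ?(lt_le_trans ltr01 D1) // mul1r; apply: le_trans D1.
by rewrite expr_le1 // ltW.
Qed.

(** * The fidelity bound for vector-valued functions *)

Section Vector.
Variables V U W : finType.
Implicit Types (f : X -> V -> C) (g : Y -> U -> C) (h : Z -> W -> C).

(** Bhattacharyya coefficient of the outcome distributions of [A f] and of the product state; its
    trivial bound for unit vectors is [frame_size]. *)
Definition fidelity f g h : R :=
  \sum_k \sum_l Num.sqrt (outcome2 (fun t v => Kop (f^~ v) t) k l) *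
    (Num.sqrt (outcome g k) * Num.sqrt (outcome h l)).

Definition influence f : R := \sum_v nsq (lin Q (f^~ v)).

Lemma one_step_unit f g h :
  nsq2 f = 1 -> nsq2 g = 1 -> nsq2 h = 1 ->
  fidelity f g h <= frame_size * (1 - gain * influence f ^+ (2 * C'.+1)).
Proof.
move=> f1 g1 h1; case/andP: c1_01 => c10 c11.
set N := frame_size; set B := fidelity f g h; set tau := influence f.
(* Unit vectors exist only over nonempty index sets. *)
have N0 : 0 < N.
  have P (I J : finType) (a : I -> J -> C) : nsq2 a = 1 -> (0 < #|I|)%N.
    move=> a1; rewrite lt0n; apply/eqP => I0.
    have : nsq2 a = 0 by rewrite /nsq2 big1 // => i _; have := fintype0 i I0.
    by rewrite a1 => /eqP; rewrite oner_eq0.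
  by rewrite /N /frame_size ltr0n !muln_gt0 (P _ _ _ g1) (P _ _ _ h1).
pose F t v := Kop (f^~ v) t.
pose S := nsq2 F.
have SE : S = \sum_v \sum_x s x * cabs2 (f x v).
  by rewrite /S -nsq2_exchange; apply: eq_bigr => v _; rewrite nsq_Kop.
have f1' : \sum_v \sum_x cabs2 (f x v) = 1 by rewrite -f1 -nsq2_exchange.
have tau0 : 0 <= tau by apply: sumr_ge0 => v _; apply: nsq_ge0.
have tau1 : tau <= 1.
  by rewrite -f1' /tau /influence; apply: ler_sum => v _; apply: Q_contr.
have S1 : S <= 1.
  rewrite SE -f1'; apply: ler_sum => v _; apply: ler_sum => x _.
  by rewrite -[leRHS]mul1r ler_wpM2r ?cabs2_ge0 //; case/andP: (s01 x).
have S0 : 0 <= S by apply: nsq2_ge0.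
pose G := \sum_t \sum_t' cabs (gap F g h t t').
have G0 : 0 <= G by do 2 (apply: sumr_ge0 => ? _); apply: cabs_ge0.
have B0 : 0 <= B.
  by do 2 (apply: sumr_ge0 => ? _); rewrite !mulr_ge0 ?sqrtr_ge0.
have sm : \sum_p outcome2 F p.1 p.2 = N * S by rewrite -pair_bigA sum_outcome2.
have sp : \sum_p outcome g p.1 * outcome h p.2 = N.
  by rewrite -(pair_bigA _ (fun k l => outcome g k * outcome h l)) sum_outcome_prod
    g1 h1 !mulr1.
have H : (16 * G) ^+ 2 <= (N * S + N) ^+ 2 - (2 * B) ^+ 2.
  have := @hellinger_le _ (fun p => outcome2 F p.1 p.2)
    (fun p => outcome g p.1 * outcome h p.2) (fun p => outcome2_ge0 F _ _)
    (fun p => mulr_ge0 (outcome_ge0 g _) (outcome_ge0 h _)).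
  rewrite sm sp.
  have -> : \sum_p Num.sqrt (outcome2 F p.1 p.2) * Num.sqrt (outcome g p.1 * outcome h p.2) = B.
    rewrite -(pair_bigA _ (fun k l => Num.sqrt (outcome2 F k l) *
      Num.sqrt (outcome g k * outcome h l))) /=.
    by do 2 (apply: eq_bigr => ? _); rewrite sqrtrM ?outcome_ge0.
  apply: le_trans; rewrite lerXn2r ?nnegrE ?mulr_ge0 //.
    by apply: sumr_ge0 => *; apply: normr_ge0.
  by apply: le_trans (gap_le F g h) _; rewrite pair_bigA.
(* [beta] is the deficit of the normalized coefficient, and [dl] the norm lost by A. *)
pose beta := 1 - B / N.
have BE : B = N * (1 - beta) by rewrite /beta subKr mulrC divfK // gt_eqF.
pose dl := 1 - S.
(* The left side of [H] is nonnegative, so [2 B <= N (S + 1)], that is [dl <= 2 beta]. *)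
have [dlb beta1] : dl <= 2 * beta /\ beta <= 1.
  split; last by rewrite /beta lerBlDr lerDl divr_ge0 // ltW.
  have : 2 * B <= N * S + N.
    rewrite -(@ler_pXn2r _ 2) ?nnegrE ?mulr_ge0 ?addr_ge0 ?mulr_ge0 // ?(ltW N0) //.
    by have := le_trans (sqr_ge0 (16 * G)) H; lra.
  rewrite BE.
  have -> : 2 * (N * (1 - beta)) = N * (2 - 2 * beta) by ring.
  have -> : N * S + N = N * (S + 1) by ring.
  by rewrite ler_pM2l // /dl; lra.
have dl0 : 0 <= dl by rewrite /dl subr_ge0.
have beta0 : 0 <= beta by lra.
(* From [H], since [(2 - dl)^2 - 4 (1 - beta)^2 <= 8 beta <= 9 beta]. *)
have GB : 16 * G <= N * 3 * Num.sqrt beta.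
  have R0 : 0 <= N * 3 * Num.sqrt beta by rewrite !mulr_ge0 ?sqrtr_ge0 // ltW.
  rewrite -(@ler_pXn2r _ 2) ?nnegrE ?mulr_ge0 ?sqrtr_ge0 //.
  apply: le_trans H _; rewrite BE !exprMn sqr_sqrtr //.
  have -> : (N * S + N) ^+ 2 = N ^+ 2 * (2 - dl) ^+ 2 by rewrite /dl; ring.
  have -> : 2 ^+ 2 * (N ^+ 2 * (1 - beta) ^+ 2) = N ^+ 2 * (2 ^+ 2 * (1 - beta) ^+ 2) by ring.
  rewrite -mulrBr -mulrA ler_wpM2l ?sqr_ge0 //.
  by have : dl <= 1 by [rewrite /dl; lra]; nra.
(* The divisor 4 gives [eta * tau = 4 kap]: the witness gains about [2 kap] on [A f] and at most
   [kap] on product states. *)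
pose t1 := tau / 4.
have t10 : 0 <= t1 by rewrite divr_ge0.
pose eta := c1 * t1 ^+ C'.
have eta0 : 0 <= eta by rewrite mulr_ge0 ?exprn_ge0 // ltW.
have eta1 : eta <= 1.
  rewrite mulr_ile1 ?exprn_ge0 ?exprn_ile1 // ?ltW //.
  by rewrite /t1; lra.
pose kap := c1 * t1 ^+ C'.+1.
have kapE : eta * tau = 4 * kap by rewrite /kap /eta exprSr /t1; field.
have kap0 : 0 <= kap by rewrite mulr_ge0 ?exprn_ge0 // ltW.
(* The mixed product state is a sum of the pure product vectors indexed by [u] and [w], so the
   scalar bound is summed. *)
have prodW : \sum_u \sum_w nsq (lin Kadj (fun t => cconj (g t.1 u * h t.2 w))) +
   eta * (\sum_u \sum_w nsq (lin QKadj (fun t => cconj (g t.1 u * h t.2 w)))) <= 1 + kap.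
  rewrite mulr_sumr -big_split /=.
  apply: (@le_trans _ _ (\sum_u \sum_w (1 + kap) * (nsq (g^~ u) * nsq (h^~ w)))).
    apply: ler_sum => u _; rewrite mulr_sumr -big_split /=; apply: ler_sum => w _.
    exact: product_witness.
  under eq_bigr => u _ do rewrite -mulr_sumr -mulr_sumr.
  by rewrite -mulr_sumr -mulr_suml !nsq2_exchange g1 h1 !mulr1.
have W1 := witness_gap Kadj F g h; have W2 := witness_gap QKadj F g h.
have E1 : 1 - 2 * dl <= \sum_v nsq (lin Kadj (F^~ v)).
  have -> : 1 - 2 * dl = \sum_v (\sum_x cabs2 (f x v) -
     2 * (\sum_x cabs2 (f x v) - \sum_x s x * cabs2 (f x v))).
    by rewrite sumrB -mulr_sumr sumrB f1' -SE.
  by apply: ler_sum => v _; apply: witness_Kop.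
have E2 : tau <= 2 * \sum_v nsq (lin QKadj (F^~ v)) + 2 * dl.
  have -> : dl = \sum_v (\sum_x cabs2 (f x v) - \sum_x s x * cabs2 (f x v)).
    by rewrite sumrB f1' -SE.
  rewrite !mulr_sumr -big_split; apply: ler_sum => v _; exact: Q_witness_Kop.
move: W1 W2; rewrite -/G.
have k2_ge0 : 0 <= (\sum_t \sum_t' cabs (gram QKadj t t')) * G.
  by rewrite mulr_ge0 //; do 2 (apply: sumr_ge0 => ? _); apply: cabs_ge0.
have gt0 := gram_total_ge0.
move=> W1 W2.
have main : kap <= 3 * dl + gram_total * G.
  rewrite /gram_total [X in _ <= _ + X]mulrDl.
  exact: (witness_arith dl0 eta0 eta1 kapE E1 E2 prodW W1 W2 k2_ge0).
have sb1 : Num.sqrt beta <= 1 by rewrite -[leRHS]sqrtr1 ler_wsqrtr.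
have sb0 := sqrtr_ge0 beta; have sbE := sqr_sqrtr beta0.
set sb := Num.sqrt beta in GB sb1 sb0 sbE.
pose L2 := 6 + gram_total * N.
have L20 : 0 < L2 by rewrite ltr_pwDl // mulr_ge0 // ltW.
(* Both errors are of order [sqrt beta]: [3 dl <= 6 beta <= 6 sb], and [G] is at most
   [3 N sb / 16]. *)
have main2 : kap <= L2 * sb.
  have h1' : gram_total * (16 * G) <= gram_total * (N * 3 * sb) by rewrite ler_wpM2l.
  have h2' : beta <= sb by rewrite -sbE expr2 -[leRHS]mulr1 ler_wpM2l.
  have h3' : 0 <= gram_total * N * sb by rewrite !mulr_ge0 // ltW.
  have h4' : L2 * sb = 6 * sb + gram_total * N * sb by rewrite /L2 mulrDl.
  have h5' : gram_total * (16 * G) = 16 * (gram_total * G) by ring.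
  have h6' : gram_total * (N * 3 * sb) = 3 * (gram_total * N * sb) by ring.
  rewrite h4'; move: main h1'; rewrite h5' h6'.
  move: h2' h3' dlb; move: (gram_total * N * sb) (gram_total * G) => ? ?.
  by lra.
have main3 : kap ^+ 2 <= L2 ^+ 2 * beta.
  have Ls0 : 0 <= L2 * sb by rewrite mulr_ge0 // ltW.
  by rewrite -sbE -exprMn lerXn2r ?nnegrE.
rewrite BE ler_pM2l // lerD2l lerN2 /gain -/N -/L2.
rewrite mulrAC ler_pdivrMr; last by rewrite mulr_gt0 ?exprn_gt0.
have -> : c1 ^+ 2 * tau ^+ (2 * C'.+1) = kap ^+ 2 * 16 ^+ C'.+1.
  have -> : tau = 4 * t1 by rewrite /t1; field.
  rewrite /kap !exprMn -!exprM [(C'.+1 * 2)%N]mulnC.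
  have -> : 4 ^+ (2 * C'.+1) = 16 ^+ C'.+1 :> R.
    by rewrite exprM; congr (_ ^+ _); rewrite expr2; lra.
  by ring.
have -> : beta * (16 ^+ C'.+1 * L2 ^+ 2) = 16 ^+ C'.+1 * (L2 ^+ 2 * beta) by ring.
by rewrite [leLHS]mulrC ler_wpM2l ?exprn_ge0.
Qed.

Lemma fidelity_scale a b c f g h : 0 <= a -> 0 <= b -> 0 <= c ->
  fidelity (fun x v => cR a * f x v) (fun y u => cR b * g y u) (fun z w => cR c * h z w) =
  a * b * c * fidelity f g h.
Proof.
move=> a0 b0 c0; rewrite /fidelity mulr_sumr; apply: eq_bigr => k _.
rewrite mulr_sumr; apply: eq_bigr => l _.
have sc (r q : R) : 0 <= r -> Num.sqrt (r ^+ 2 * q) = r * Num.sqrt q.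
  by move=> r0; rewrite sqrtrM ?sqr_ge0 // sqrtr_sqr ger0_norm.
have -> : outcome2 (fun t v => Kop (fun x => cR a * f x v) t) k l =
    a ^+ 2 * outcome2 (fun t v => Kop (f^~ v) t) k l.
  rewrite /outcome2 -cabs2_cR -nsqZ; apply: eq_bigr => v _; congr cabs2.
  have E t : Kop (fun x => cR a * f x v) t = cR a * Kop (f^~ v) t.
    by rewrite /Kop mulr_sumr; apply: eq_bigr => x _; rewrite mulrCA.
  by rewrite /pol2 /polc !E; ring.
have sco (I J : finType) (r : R) (q : I -> J -> C) k' :
    outcome (fun y u => cR r * q y u) k' = r ^+ 2 * outcome q k'.
  rewrite /outcome -cabs2_cR -nsqZ; apply: eq_bigr => u _; congr cabs2.
  by rewrite /pol; ring.
by rewrite !sco !sc //; ring.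
Qed.

(** * The form twisted by 1 + rho Q *)

Definition amplify (rho : R) f x v : C := f x v + cR rho * lin Q (f^~ v) x.

Hypothesis Q_idem : forall (f : X -> C) x, lin Q (lin Q f) x = lin Q f x.
Hypothesis Q_orth : forall (rho : R) (f : X -> C),
  nsq (fun x => f x + cR rho * lin Q f x) = nsq f + (2 * rho + rho ^+ 2) * nsq (lin Q f).
Variables (t0 rho : R).
Hypothesis t0_ge0 : 0 <= t0.
Hypothesis rho01 : 0 <= rho <= 1.
(* With this choice of rho the loss 3/2 rho tau exceeds gain * tau^(2C) only for
   tau < t0, and then by at most gain * t0^(2C). *)
Hypothesis rhoE : 3 / 2 * rho = gain * t0 ^+ (2 * C').+1.

Lemma linZ (a : C) (p : X -> C) x : lin Q (fun x => a * p x) x = a * lin Q p x.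
Proof. by rewrite /lin mulr_sumr; apply: eq_bigr => x' _; rewrite mulrCA. Qed.

Lemma linD (p q : X -> C) x : lin Q (fun x => p x + q x) x = lin Q p x + lin Q q x.
Proof. by rewrite /lin -big_split; apply: eq_bigr => x' _; rewrite mulrDr. Qed.

Lemma amplified_step_unit f g h : nsq2 f = 1 -> nsq2 g = 1 -> nsq2 h = 1 ->
  fidelity (amplify rho f) g h <= frame_size * (1 + gain * t0 ^+ (2 * C').+2).
Proof.
move=> f1 g1 h1; have g0 := ltW gain_gt0; case/andP: rho01 => r0 r1.
set f' := amplify rho f; set tau := influence f.
have N0 : 0 <= frame_size by rewrite /frame_size ler0n.
have tau0 : 0 <= tau by apply: sumr_ge0 => v _; apply: nsq_ge0.
have tau1 : tau <= 1.
  by rewrite -f1 -nsq2_exchange /tau /influence; apply: ler_sum => v _; apply: Q_contr.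
have nE : nsq2 f' = 1 + (2 * rho + rho ^+ 2) * tau.
  suff -> : nsq2 f' = nsq2 f + (2 * rho + rho ^+ 2) * tau by rewrite f1.
  rewrite -!nsq2_exchange mulr_sumr -big_split /=.
  by apply: eq_bigr => v _; rewrite -Q_orth.
have iE : influence f' = (1 + rho) ^+ 2 * tau.
  rewrite /tau /influence mulr_sumr; apply: eq_bigr => v _.
  rewrite -cabs2_cR -nsqZ; apply: eq_bigr => x _; congr cabs2.
  by rewrite /f' /amplify linD linZ Q_idem cRD cR1; ring.
pose n := Num.sqrt (nsq2 f').
have n2 : n ^+ 2 = 1 + (2 * rho + rho ^+ 2) * tau by rewrite sqr_sqrtr ?nsq2_ge0.
have n0 : 0 <= n := sqrtr_ge0 _.
have p0 : 0 <= (2 * rho + rho ^+ 2) * tau.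
  by rewrite mulr_ge0 // addr_ge0 ?sqr_ge0 // mulr_ge0.
have n1 : 1 <= n.
  rewrite -(@ler_pXn2r _ 2) ?nnegrE // expr1n n2; lra.
have np : 0 < n by lra.
have rt0 : 0 <= rho * tau by rewrite mulr_ge0.
(* Squared, the right side is at least [1 + 3 rho tau], and [rho <= 1] gives
   [2 rho + rho^2 <= 3 rho]. *)
have n3 : n <= 1 + 3 / 2 * rho * tau.
  rewrite -(@ler_pXn2r _ 2) ?nnegrE //; last by lra.
  have : rho ^+ 2 * tau <= rho * tau by rewrite ler_wpM2r // expr2 -[leRHS]mulr1 ler_wpM2l.
  have := sqr_ge0 (3 / 2 * rho * tau).
  by rewrite n2; lra.
pose f'' x v := cR n^-1 * f' x v.
have f''1 : nsq2 f'' = 1.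
  rewrite /nsq2 (eq_bigr (fun x => cabs2 (cR n^-1) * nsq (f' x))) => [|x _]; last exact: nsqZ.
  by rewrite -mulr_sumr cabs2_cR exprVn -[\sum_x _]/(nsq2 f') nE -n2 mulVf // expf_neq0 // gt_eqF.
have i''E : influence f'' = (n ^+ 2)^-1 * ((1 + rho) ^+ 2 * tau).
  rewrite -iE /influence mulr_sumr; apply: eq_bigr => v _.
  by rewrite -exprVn -cabs2_cR -nsqZ; apply: eq_bigr => x _; rewrite linZ.
(* Normalizing does not lower the influence: [n^2 <= (1 + rho)^2] because [tau <= 1]. *)
have i''tau : tau <= influence f''.
  rewrite i''E mulrC ler_pdivlMr ?exprn_gt0 // mulrC ler_wpM2r // n2.
  have : (2 * rho + rho ^+ 2) * tau <= 2 * rho + rho ^+ 2.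
    by rewrite -[leRHS]mulr1 ler_wpM2l // addr_ge0 ?sqr_ge0 // mulr_ge0.
  lra.
have fE : fidelity f' g h = n * fidelity f'' g h.
  have := @fidelity_scale n 1 1 f'' g h n0 ler01 ler01; rewrite !mulr1 => <-.
  congr fidelity; apply: funext => i; apply: funext => j; rewrite ?cR1 ?mul1r //.
  by rewrite /f'' mulrA -cRM mulfV ?gt_eqF // cR1 mul1r.
rewrite fE.
apply: le_trans (ler_wpM2l n0 (one_step_unit f''1 g1 h1)) _.
rewrite mulrCA ler_wpM2l //.
set K2 := (2 * C'.+1)%N; have K2E : K2 = (2 * C').+2 by rewrite /K2 mulnS.
have Pt : tau ^+ K2 <= influence f'' ^+ K2.
  by rewrite lerXn2r ?nnegrE //; apply: le_trans tau0 i''tau.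
apply: (@le_trans _ _ (n * (1 - gain * tau ^+ K2))).
  by rewrite ler_wpM2l // lerD2l lerN2 ler_wpM2l.
rewrite K2E; set q := gain * tau ^+ _.
have q0 : 0 <= q by rewrite mulr_ge0 ?exprn_ge0.
(* With the choice of [rho], the loss [3/2 rho tau] is at most [q + gain t0^(2C'+2)], and [q] is
   recovered from the one-step bound. *)
have T := tradeoff (2 * C').+1 tau0 t0_ge0.
have {}T : gain * (t0 ^+ (2 * C').+1 * tau) <= q + gain * t0 ^+ (2 * C').+2.
  by rewrite /q -mulrDr ler_wpM2l.
rewrite mulrA -rhoE in T.
have p'0 : 0 <= gain * t0 ^+ (2 * C').+2 by rewrite mulr_ge0 ?exprn_ge0.
have [qn|qp] := leP (1 - q) 0.
  apply: (@le_trans _ _ 0); first by rewrite mulr_ge0_le0.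
  by rewrite addr_ge0.
apply: le_trans (ler_wpM2r (ltW qp) n3) _.
have : 0 <= (rho * tau) * q by rewrite mulr_ge0.
by lra.
Qed.

(** Homogeneity reduces to unit vectors; vanishing arguments cannot be normalized and are treated
    first. *)
Lemma amplified_step f g h :
  fidelity (amplify rho f) g h <= frame_size * (1 + gain * t0 ^+ (2 * C').+2) *
     (Num.sqrt (nsq2 f) * Num.sqrt (nsq2 g) * Num.sqrt (nsq2 h)).
Proof.
have unit (I J : finType) (a : I -> J -> C) : nsq2 a != 0 ->
   exists2 a', nsq2 a' = 1 & a = fun i j => cR (Num.sqrt (nsq2 a)) * a' i j.
  move=> an; have ap : 0 < nsq2 a by rewrite lt_neqAle eq_sym an nsq2_ge0.
  exists (fun i j => cR (Num.sqrt (nsq2 a))^-1 * a i j).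
    rewrite /nsq2 (eq_bigr (fun i => cabs2 (cR (Num.sqrt (nsq2 a))^-1) * nsq (a i))) => [|i _].
      by rewrite -mulr_sumr cabs2_cR exprVn sqr_sqrtr ?nsq2_ge0 // mulVf.
    exact: nsqZ.
  apply: funext => i; apply: funext => j.
  by rewrite mulrA -cRM mulfV ?cR1 ?mul1r // gt_eqF // sqrtr_gt0.
have zero (I J : finType) (a : I -> J -> C) : nsq2 a = 0 -> a = fun i j => cR 0 * a i j.
  move=> /eqP; rewrite psumr_eq0 => [|i _]; last exact: nsq_ge0.
  move=> /allP H; apply: funext => i; apply: funext => j; rewrite cR0 mul0r.
  by apply: (@nsq_eq0 _ _ (a i)); apply/eqP; apply: H; rewrite mem_index_enum.
have one (I J : finType) (a : I -> J -> C) : a = fun i j => cR 1 * a i j.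
  by apply: funext => i; apply: funext => j; rewrite cR1 mul1r.
have ampZ (a : R) f' : amplify rho (fun x v => cR a * f' x v) =
    fun x v => cR a * amplify rho f' x v.
  by apply: funext => x; apply: funext => v; rewrite /amplify linZ; ring.
have [f0|fn] := eqVneq (nsq2 f) 0.
  rewrite (zero _ _ _ f0) ampZ (one _ _ g) (one _ _ h) fidelity_scale // !mul0r.
  by rewrite -(zero _ _ _ f0) f0 sqrtr0 !mul0r mulr0.
have [g0|gn] := eqVneq (nsq2 g) 0.
  rewrite (one _ _ (amplify _ _)) (zero _ _ _ g0) (one _ _ h) fidelity_scale // mulr0 !mul0r.
  by rewrite -(zero _ _ _ g0) g0 sqrtr0 mulr0 !mul0r mulr0.
have [h0|hn] := eqVneq (nsq2 h) 0.
  rewrite (one _ _ (amplify _ _)) (one _ _ g) (zero _ _ _ h0) fidelity_scale // mulr0 !mul0r.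
  by rewrite -(zero _ _ _ h0) h0 sqrtr0 !mulr0.
have [f' f'1 fE] := unit _ _ _ fn.
have [g' g'1 gE] := unit _ _ _ gn.
have [h' h'1 hE] := unit _ _ _ hn.
rewrite [in leLHS]fE [in leLHS]gE [in leLHS]hE ampZ fidelity_scale ?sqrtr_ge0 //.
rewrite [leRHS]mulrC ler_wpM2l ?mulr_ge0 ?sqrtr_ge0 //.
exact: amplified_step_unit.
Qed.

(** [ka], [pv], [pu], [pw] encode a trilinear form in the remaining coordinates, with constant [e].
    Resolving the new coordinate in the frame applies that form to the coefficient vectors of each
    outcome; the resulting norms sum to [fidelity]. *)
Lemma tensor_step (Om : finType) (ka : Om -> C) (pv : Om -> V) (pu : Om -> U) (pw : Om -> W)
    (e : R) : 0 <= e ->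
  (forall (f : V -> C) (g : U -> C) (h : W -> C), cabs (\sum_o ka o * f (pv o) * (g (pu o) * h (pw o))) <=
     e * (Num.sqrt (nsq f) * (Num.sqrt (nsq g) * Num.sqrt (nsq h)))) ->
  forall f g h,
  cabs (\sum_t \sum_o ka o * Kop (amplify rho f ^~ (pv o)) t *
          (g t.1 (pu o) * h t.2 (pw o))) <=
  e * (1 + gain * t0 ^+ (2 * C').+2) *
     (Num.sqrt (nsq2 f) * Num.sqrt (nsq2 g) * Num.sqrt (nsq2 h)).
Proof.
move=> e0 He f g h.
have [N0|Nn] := eqVneq frame_size 0.
  have YZ0 : (#|Y| * #|Z| = 0)%N.
    by move: N0 => /eqP; rewrite /frame_size pnatr_eq0 -mulnA muln_eq0 => /eqP.
  rewrite big1 => [|t _]; last by have := @fintype0 _ t; rewrite card_prod => /(_ YZ0).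
  rewrite cabs0 !mulr_ge0 ?sqrtr_ge0 // addr_ge0 // mulr_ge0 ?exprn_ge0 //.
  exact: ltW gain_gt0.
have Np : 0 < frame_size by rewrite lt_neqAle eq_sym Nn /frame_size ler0n.
rewrite -(ler_pM2l Np).
have -> : frame_size * cabs (\sum_t \sum_o ka o * Kop (amplify rho f ^~ (pv o)) t *
          (g t.1 (pu o) * h t.2 (pw o))) =
  cabs (\sum_k \sum_l \sum_o ka o * pol2 (Kop (amplify rho f ^~ (pv o))) k l *
     (pol (g^~ (pu o)) k * pol (h^~ (pw o)) l)).
  rewrite -[X in X * _](ger0_norm (ltW Np)) -cabs_cR -cabsM; congr cabs.
  rewrite mulr_sumr.
  under [RHS]eq_bigr => k _ do rewrite exchange_big /=.
  rewrite [RHS]exchange_big /=.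
  under [LHS]eq_bigr => t _ do rewrite mulr_sumr.
  rewrite exchange_big; apply: eq_bigr => o _ /=.
  transitivity (ka o * (\sum_k \sum_l pol2 (Kop (amplify rho f ^~ (pv o))) k l *
     (pol (g^~ (pu o)) k * pol (h^~ (pw o)) l))); last first.
    rewrite mulr_sumr; apply: eq_bigr => k _.
    by rewrite mulr_sumr; apply: eq_bigr => l _; rewrite mulrA.
  rewrite pol2_resolution /frame_size cR_nat mulrCA mulr_sumr mulr_sumr.
  by apply: eq_bigr => t _; rewrite -!mulrA.
(* For each outcome [(k, l)] the bound [He] produces exactly the three square roots in
   [fidelity]. *)
apply: (@le_trans _ _ (e * fidelity (amplify rho f) g h)).
  rewrite /fidelity mulr_sumr; apply: le_trans (cabs_sum _) _; apply: ler_sum => k _.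
  rewrite mulr_sumr; apply: le_trans (cabs_sum _) _; apply: ler_sum => l _.
  exact: (He (fun v => pol2 (Kop (amplify rho f ^~ v)) k l)
    (fun u => pol (g^~ u) k) (fun w => pol (h^~ w) l)).
apply: le_trans (ler_wpM2l e0 (amplified_step f g h)) _.
by rewrite le_eqVlt; apply/orP; left; apply/eqP; ring.
Qed.

End Vector.

End OneStep.

(** * Tensor powers *)

Section FinfunSums.
Context {T : finType} {n : nat}.

Definition fcons (a : T) (w : {ffun 'I_n -> T}) : {ffun 'I_n.+1 -> T} :=
  [ffun i => if unlift ord0 i is Some j then w j else a].

Lemma fcons0 a w : fcons a w ord0 = a.
Proof. by rewrite ffunE unlift_none. Qed.

Lemma fconsS a w j : fcons a w (lift ord0 j) = w j.
Proof. by rewrite ffunE liftK. Qed.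

Lemma sum_fcons (V : nmodType) (phi : {ffun 'I_n.+1 -> T} -> V) :
  \sum_w phi w = \sum_a \sum_w phi (fcons a w).
Proof.
rewrite pair_bigA /= (reindex (fun p : T * {ffun 'I_n -> T} => fcons p.1 p.2)) //=.
exists (fun w => (w ord0, [ffun j => w (lift ord0 j)])) => [[a w]|w] _ /=.
  by rewrite fcons0; congr pair; apply/ffunP => j; rewrite ffunE fconsS.
apply/ffunP => i; case: (unliftP ord0 i) => [j ->|->]; last by rewrite fcons0.
by rewrite fconsS ffunE.
Qed.

Lemma prod_fcons (V : comPzSemiRingType) (phi : T -> V) a w :
  \prod_i phi (fcons a w i) = phi a * \prod_i phi (w i).
Proof.
by rewrite big_ord_recl fcons0; congr (_ * _); apply: eq_bigr => i _; rewrite fconsS.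
Qed.

End FinfunSums.

Lemma map_fcons (T T' : finType) n (p : T -> T') a (w : {ffun 'I_n -> T}) :
  [ffun i => p (fcons a w i)] = fcons (p a) [ffun i => p (w i)].
Proof.
apply/ffunP => i; rewrite ffunE; case: (unliftP ord0 i) => [j ->|->].
  by rewrite !fconsS ffunE.
by rewrite !fcons0.
Qed.

Lemma sum_ffun_pair (A B : finType) n (V : nmodType) (phi : {ffun 'I_n -> A * B} -> V) :
  \sum_w phi w = \sum_(a : {ffun 'I_n -> A}) \sum_(b : {ffun 'I_n -> B}) phi [ffun i => (a i, b i)].
Proof.
rewrite pair_bigA /=.
rewrite (reindex (fun p : {ffun 'I_n -> A} * {ffun 'I_n -> B} => [ffun i => (p.1 i, p.2 i)])) //=.
exists (fun w => ([ffun i => (w i).1], [ffun i => (w i).2])) => [[a b]|w] _ /=.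
  by congr pair; apply/ffunP => j; rewrite !ffunE.
by apply/ffunP => i; rewrite !ffunE; case: (w i).
Qed.

Section TensorPower.
Context {R : realType} {X Y Z : finType}.
Local Notation C := R[i].
Variables (K : X -> Y * Z -> C) (alpha : R).

Definition power_form n (F : {ffun 'I_n -> X} -> C) (G : {ffun 'I_n -> Y} -> C)
    (H : {ffun 'I_n -> Z} -> C) : C :=
  \sum_(w : {ffun 'I_n -> X * (Y * Z)}) (\prod_i K (w i).1 (w i).2) *
    F [ffun i => (w i).1] * (G [ffun i => (w i).2.1] * H [ffun i => (w i).2.2]).

Hypothesis alpha_ge0 : 0 <= alpha.
Hypothesis step : forall (V U W Om : finType) (ka : Om -> C)
    (pv : Om -> V) (pu : Om -> U) (pw : Om -> W) (e : R), 0 <= e ->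
  (forall (f : V -> C) (g : U -> C) (h : W -> C),
     cabs (\sum_o ka o * f (pv o) * (g (pu o) * h (pw o))) <=
     e * (Num.sqrt (nsq f) * (Num.sqrt (nsq g) * Num.sqrt (nsq h)))) ->
  forall (f : X -> V -> C) (g : Y -> U -> C) (h : Z -> W -> C),
  cabs (\sum_t \sum_o ka o * (\sum_x K x t * f x (pv o)) * (g t.1 (pu o) * h t.2 (pw o))) <=
  e * alpha * (Num.sqrt (nsq2 f) * Num.sqrt (nsq2 g) * Num.sqrt (nsq2 h)).

Lemma nsq_fcons (T : finType) n (F : {ffun 'I_n.+1 -> T} -> C) :
  nsq F = nsq2 (fun a w => F (fcons a w)).
Proof. exact: sum_fcons. Qed.

(** Induction on [n]: the other coordinates form the auxiliary spaces of the vector-valued step,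
    which is why scalar functions do not suffice there. *)
Lemma power_form_le n F G H :
  cabs (@power_form n F G H) <=
  alpha ^+ n * (Num.sqrt (nsq F) * (Num.sqrt (nsq G) * Num.sqrt (nsq H))).
Proof.
elim: n F G H => [|n IH] F G H.
  have E (T : finType) (w : {ffun 'I_0 -> T}) : w = ffun0 (card_ord 0).
    by apply/ffunP => -[].
  have sum0 (T : finType) (V : nmodType) (phi : {ffun 'I_0 -> T} -> V) :
      \sum_w phi w = phi (ffun0 (card_ord 0)).
    by rewrite (big_pred1 (ffun0 (card_ord 0))) // => w; rewrite /= (E _ w) eqxx.
  rewrite /power_form expr0 mul1r /nsq !sum0 big_ord0 mul1r !cabsM.
  by rewrite !(E _ [ffun i => _]).
have -> : power_form F G H = \sum_t \sum_(w : {ffun 'I_n -> X * (Y * Z)})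
    (\prod_i K (w i).1 (w i).2) *
    (\sum_x K x t * F (fcons x [ffun i => (w i).1])) *
    (G (fcons t.1 [ffun i => (w i).2.1]) * H (fcons t.2 [ffun i => (w i).2.2])).
  transitivity (\sum_x \sum_t \sum_(w : {ffun 'I_n -> X * (Y * Z)})
    (\prod_i K (fcons (x, t) w i).1 (fcons (x, t) w i).2) *
    F [ffun i => (fcons (x, t) w i).1] *
    (G [ffun i => (fcons (x, t) w i).2.1] * H [ffun i => (fcons (x, t) w i).2.2])).
    by rewrite /power_form sum_fcons [RHS]pair_bigA /=; apply: eq_bigr => -[x t] _.
  rewrite [LHS]exchange_big /=; apply: eq_bigr => t _.
  rewrite [LHS]exchange_big /=; apply: eq_bigr => w _.
  rewrite mulr_sumr mulr_suml; apply: eq_bigr => x _.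
  rewrite (prod_fcons (fun p => K p.1 p.2)) (map_fcons fst).
  rewrite (map_fcons (fun p : X * (Y * Z) => p.2.1)) (map_fcons (fun p : X * (Y * Z) => p.2.2)) /=.
  by ring.
rewrite !nsq_fcons exprSr mulrA.
exact: (@step _ _ _ _ (fun w : {ffun 'I_n -> X * (Y * Z)} => \prod_i K (w i).1 (w i).2)
  (fun w => [ffun i => (w i).1]) (fun w => [ffun i => (w i).2.1])
  (fun w => [ffun i => (w i).2.2]) _ (exprn_ge0 n alpha_ge0) IH
  (fun x w => F (fcons x w)) (fun y w => G (fcons y w)) (fun z w => H (fcons z w))).
Qed.

End TensorPower.

Lemma sqrtr_prod {R : realType} (I : finType) (f : I -> R) : (forall i, 0 <= f i) ->
  Num.sqrt (\prod_i f i) = \prod_i Num.sqrt (f i).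
Proof.
move=> f0; suff: 0 <= \prod_i f i /\ Num.sqrt (\prod_i f i) = \prod_i Num.sqrt (f i) by case.
elim/big_rec2: _ => [|i y x _ [y0 <-]]; first by rewrite sqrtr1.
by rewrite sqrtrM // mulr_ge0.
Qed.

(** * The base case in unweighted L2 *)

Section HermitianProjection.
Context {R : realType} {X : finType}.
Local Notation C := R[i].
Variable Q : X -> X -> C.
Hypothesis Q_herm : forall x x', Q x' x = cconj (Q x x').
Hypothesis Q_idem : forall (f : X -> C) x, lin Q (lin Q f) x = lin Q f x.

(** A Hermitian idempotent satisfies [Q = Q^* Q]. *)
Lemma inner_proj f : \sum_x cconj (f x) * lin Q f x = cR (nsq (lin Q f)).
Proof.
rewrite nsqE; symmetry.
transitivity (\sum_x \sum_x' cconj (f x') * (Q x' x * lin Q f x)).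
  apply: eq_bigr => x _; rewrite {1}/lin cconj_sum mulr_suml.
  by apply: eq_bigr => x' _; rewrite cconjM -Q_herm; ring.
rewrite exchange_big; apply: eq_bigr => x _ /=.
by rewrite -mulr_sumr -/(lin Q (lin Q f) x) Q_idem.
Qed.

Lemma nsq_proj (rho : R) f :
  nsq (fun x => f x + cR rho * lin Q f x) = nsq f + (2 * rho + rho ^+ 2) * nsq (lin Q f).
Proof.
apply: cRI; rewrite nsqE.
transitivity (\sum_x cconj (f x) * f x + cR rho * (\sum_x cconj (f x) * lin Q f x) +
   cR rho * cconj (\sum_x cconj (f x) * lin Q f x) +
   cR (rho ^+ 2) * \sum_x cconj (lin Q f x) * lin Q f x).
  rewrite cconj_sum !mulr_sumr -!big_split; apply: eq_bigr => x _ /=.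
  by rewrite cconjD !cconjM cconjK cconj_cR expr2 cRM; ring.
rewrite inner_proj cconj_cR -!nsqE cRD cRM cRD cRM (cR_nat 2); ring.
Qed.

Lemma nsq_proj_le f : nsq (lin Q f) <= nsq f.
Proof.
(* At [rho = -1] the factor [2 rho + rho^2] equals -1. *)
have := nsq_ge0 (fun x => f x + cR (-1) * lin Q f x); rewrite nsq_proj.
by rewrite sqrrN expr1n; lra.
Qed.

End HermitianProjection.

(** * The kernel of one coordinate and the projection onto the span of B_2 *)

Section SingleCoordinate.
Context {R : realType} {Sg Gm Ph : finType}.
Local Notation C := R[i].
Variables (mu : Sg * Gm * Ph -> R) (S' : {set Sg}) (T : Sg -> Gm -> Ph -> C).
Hypothesis mu_distr : is_distr mu.

Local Notation px := (margx mu).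
Local Notation py := (margy mu).
Local Notation pz := (margz mu).

Lemma mu_ge0 t : 0 <= mu t. Proof. by case: mu_distr. Qed.

Lemma margx_ge0 a : 0 <= px a.
Proof. by do 2 (apply: sumr_ge0 => ? _); apply: mu_ge0. Qed.
Lemma margy_ge0 b : 0 <= py b.
Proof. by do 2 (apply: sumr_ge0 => ? _); apply: mu_ge0. Qed.
Lemma margz_ge0 c : 0 <= pz c.
Proof. by do 2 (apply: sumr_ge0 => ? _); apply: mu_ge0. Qed.

Lemma term_le_sum (I : finType) (f : I -> R) i : (forall j, 0 <= f j) -> f i <= \sum_j f j.
Proof. by move=> f0; rewrite (bigD1 i) //= lerDl; apply: sumr_ge0. Qed.

Lemma mu_le_margx a b c : mu (a, b, c) <= px a.
Proof.
apply: le_trans (term_le_sum b _) => [|b']; last by apply: sumr_ge0 => ? _; apply: mu_ge0.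
by apply: (term_le_sum (f := fun c => mu (a, b, c))) => ?; apply: mu_ge0.
Qed.
Lemma mu_le_margy a b c : mu (a, b, c) <= py b.
Proof.
apply: le_trans (term_le_sum a _) => [|b']; last by apply: sumr_ge0 => ? _; apply: mu_ge0.
by apply: (term_le_sum (f := fun c => mu (a, b, c))) => ?; apply: mu_ge0.
Qed.
Lemma mu_le_margz a b c : mu (a, b, c) <= pz c.
Proof.
apply: le_trans (term_le_sum a _) => [|b']; last by apply: sumr_ge0 => ? _; apply: mu_ge0.
by apply: (term_le_sum (f := fun b => mu (a, b, c))) => ?; apply: mu_ge0.
Qed.

(* Null points are harmless: there the inverse is 0^-1 = 0 and mu vanishes too. *)
Definition kernel (a : Sg) (t : Gm * Ph) : C :=
  cR (mu (a, t.1, t.2) * ((Num.sqrt (px a))^-1 *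
     ((Num.sqrt (py t.1))^-1 * (Num.sqrt (pz t.2))^-1))) * T a t.1 t.2.

Definition weigh {I : Type} (p : I -> R) (f : I -> C) (i : I) : C := cR (Num.sqrt (p i)) * f i.

Lemma kernelE a b c : cR (mu (a, b, c)) * T a b c =
  kernel a (b, c) * cR (Num.sqrt (px a)) * (cR (Num.sqrt (py b)) * cR (Num.sqrt (pz c))).
Proof.
rewrite /kernel /=; have [m0|mn] := eqVneq (mu (a, b, c)) 0.
  by rewrite m0 !mul0r.
have mp : 0 < mu (a, b, c) by rewrite lt_neqAle eq_sym mn mu_ge0.
have x0 : Num.sqrt (px a) != 0.
  by rewrite gt_eqF // sqrtr_gt0; apply: lt_le_trans mp (mu_le_margx _ _ _).
have y0 : Num.sqrt (py b) != 0.
  by rewrite gt_eqF // sqrtr_gt0; apply: lt_le_trans mp (mu_le_margy _ _ _).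
have z0 : Num.sqrt (pz c) != 0.
  by rewrite gt_eqF // sqrtr_gt0; apply: lt_le_trans mp (mu_le_margz _ _ _).
transitivity (cR (mu (a, b, c) * ((Num.sqrt (px a))^-1 * ((Num.sqrt (py b))^-1 *
   (Num.sqrt (pz c))^-1)) * (Num.sqrt (px a) * (Num.sqrt (py b) * Num.sqrt (pz c)))) * T a b c).
  by congr (cR _ * _); field; rewrite x0 y0 z0.
by rewrite cRM [cR (Num.sqrt (px a) * _)]cRM [cR (Num.sqrt (py b) * _)]cRM; ring.
Qed.

Hypothesis T_disk : forall a b c, 0 < mu (a, b, c) -> inD (T a b c).
Hypothesis yz_indep : forall b c, margyz mu b c = py b * pz c.
Hypothesis x_det : forall a a' b c, 0 < mu (a, b, c) -> 0 < mu (a', b, c) -> a = a'.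

Definition col_nsq (a : Sg) : R := nsq (kernel a).

Lemma kernel_eq0 a t : mu (a, t.1, t.2) = 0 -> kernel a t = 0.
Proof. by rewrite /kernel => ->; rewrite !mul0r. Qed.

(** Distinct columns have disjoint supports, because [(y, z)] determines [x]. *)
Lemma gram_kernel a a' :
  \sum_t cconj (kernel a t) * kernel a' t = if a == a' then cR (col_nsq a) else 0.
Proof.
have [<-|ne] := eqVneq a a'; first by rewrite /col_nsq nsqE.
apply: big1 => t _; have [m0|mn] := eqVneq (mu (a, t.1, t.2)) 0.
  by rewrite kernel_eq0 // -cR0 cconj_cR cR0 mul0r.
have [m0'|mn'] := eqVneq (mu (a', t.1, t.2)) 0; first by rewrite (@kernel_eq0 a') // mulr0.
have pos (r : R) : 0 <= r -> r != 0 -> 0 < r by move=> r0 rn; rewrite lt_neqAle eq_sym rn.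
by move: ne; rewrite (@x_det a a' t.1 t.2) ?eqxx //; apply: pos => //; apply: mu_ge0.
Qed.

Lemma col_nsq01 a : 0 <= col_nsq a <= 1.
Proof.
rewrite nsq_ge0 /=.
apply: (@le_trans _ _ (\sum_(t : Gm * Ph) mu (a, t.1, t.2) / px a)).
  apply: ler_sum => -[b c] _; have [m0|mn] := eqVneq (mu (a, b, c)) 0.
    by rewrite kernel_eq0 // cabs2_0 /= m0 mul0r.
  have mp : 0 < mu (a, b, c) by rewrite lt_neqAle eq_sym mn mu_ge0.
  have xp : 0 < px a := lt_le_trans mp (mu_le_margx _ _ _).
  have yp : 0 < py b := lt_le_trans mp (mu_le_margy _ _ _).
  have zp : 0 < pz c := lt_le_trans mp (mu_le_margz _ _ _).
  (* Only [a] contributes to [margyz mu b c], so independence evaluates [mu]; the squared kernel is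
     then at most [mu / px]. *)
  have mE : mu (a, b, c) = py b * pz c.
    rewrite -yz_indep /margyz (bigD1 a) //= big1 ?addr0 // => a' ne.
    apply/eqP; apply/negPn/negP => m'n; move: ne; rewrite (@x_det a' a b c) ?eqxx //.
    by rewrite lt_neqAle eq_sym m'n mu_ge0.
  rewrite /kernel cabs2M cabs2_cR /= !exprMn !exprVn !sqr_sqrtr ?(ltW xp) ?(ltW yp) ?(ltW zp) //.
  have -> : mu (a, b, c) ^+ 2 * ((px a)^-1 * ((py b)^-1 * (pz c)^-1)) = mu (a, b, c) / px a.
    by rewrite mE; field; rewrite !gt_eqF.
  rewrite -[leRHS]mulr1 ler_wpM2l ?divr_ge0 ?mu_ge0 ?margx_ge0 //.
  have := T_disk mp; rewrite /inD => Tab.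
  by rewrite -sqr_cabs expr_le1 ?cabs_ge0.
rewrite -mulr_suml -(pair_bigA _ (fun b c => mu (a, b, c))) /= -/(px a).
have [->|xn] := eqVneq (px a) 0; first by rewrite mul0r.
by rewrite mulfV.
Qed.

Definition mass : R := \sum_(a in S') px a.
(** The normalized indicator of [S'] in unweighted coordinates. If [S'] is null, division by zero
    makes it vanish. *)
Definition dir (a : Sg) : R := (a \in S')%:R * Num.sqrt (px a) / Num.sqrt mass.
(* Null points of S' are left out, since Ieff does not see them; dir vanishes there. *)
Definition effective (a : Sg) : bool := (a \in S') && (px a != 0).
(** Orthogonal projection onto the functions carried by effective points and orthogonal to [dir]:
    the span of B_2 after weighting. *)
Definition Qeff (a a' : Sg) : C := cR ((effective a && (a == a'))%:R - dir a * dir a').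

Lemma mass_ge0 : 0 <= mass.
Proof. by apply: sumr_ge0 => a _; apply: margx_ge0. Qed.

Lemma effective_mass a : effective a -> 0 < mass.
Proof.
case/andP => aS pa; rewrite /mass (bigD1 a) //= ltr_pwDl ?sumr_ge0 //.
  by rewrite lt_neqAle eq_sym pa margx_ge0.
by move=> *; apply: margx_ge0.
Qed.

Lemma dir_eq0 a : ~~ effective a -> dir a = 0.
Proof.
rewrite /effective negb_and negbK /dir => /orP[/negbTE ->|/eqP ->]; first by rewrite !mul0r.
by rewrite sqrtr0 mulr0 mul0r.
Qed.

Lemma sum_dir2 : 0 < mass -> \sum_a dir a ^+ 2 = 1.
Proof.
move=> m0.
transitivity (mass / mass); last by rewrite mulfV // gt_eqF.
rewrite {1}/mass mulr_suml [RHS]big_mkcond; apply: eq_bigr => a _.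
rewrite /dir !exprMn exprVn !sqr_sqrtr ?margx_ge0 ?mass_ge0 //.
by case: (a \in S'); rewrite ?expr1n ?mul1r ?expr0n ?mul0r.
Qed.

Definition dir_coef (f : Sg -> C) : C := \sum_a cR (dir a) * f a.

Lemma lin_Qeff f a : lin Qeff f a = (effective a)%:R * f a - cR (dir a) * dir_coef f.
Proof.
rewrite /lin /Qeff /dir_coef mulr_sumr.
transitivity (\sum_a' ((effective a && (a == a'))%:R * f a' - cR (dir a) * (cR (dir a') * f a'))).
  by apply: eq_bigr => a' _; rewrite cRB cRM cR_nat; ring.
rewrite sumrB; congr (_ - _); rewrite (bigD1 a) //= eqxx andbT big1 ?addr0 // => a' ne.
by rewrite eq_sym (negbTE ne) andbF mul0r.
Qed.

Lemma Qeff_herm a a' : Qeff a' a = cconj (Qeff a a').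
Proof.
rewrite /Qeff cconj_cR [dir a' * _]mulrC; congr (cR (_%:R - _)).
by have [->|] := eqVneq a a'; rewrite ?andbF // eqxx.
Qed.

Lemma dir_coef_Qeff f : dir_coef (lin Qeff f) = 0.
Proof.
transitivity (\sum_a (cR (dir a) * f a - cR (dir a ^+ 2) * dir_coef f)).
  apply: eq_bigr => a _; rewrite lin_Qeff expr2 cRM.
  have [ea|/dir_eq0 ->] := boolP (effective a); first by rewrite mul1r; ring.
  by rewrite cR0 !mul0r subrr.
rewrite sumrB -mulr_suml -cR_sum.
have [mp|] := ltP 0 mass; first by rewrite sum_dir2 // cR1 mul1r subrr.
move=> mle; have d0 a : dir a = 0.
  by apply: dir_eq0; apply/negP => /effective_mass; rewrite ltNge mle.
have z : dir_coef f = 0 by rewrite /dir_coef big1 // => a _; rewrite d0 cR0 mul0r.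
by rewrite -/(dir_coef f) z mulr0 subrr.
Qed.

Lemma Qeff_idem f a : lin Qeff (lin Qeff f) a = lin Qeff f a.
Proof.
rewrite lin_Qeff dir_coef_Qeff mulr0 subr0.
have [|ne] := boolP (effective a); first by rewrite mul1r.
by rewrite lin_Qeff (negbTE ne) (dir_eq0 ne) cR0 !mul0r subrr.
Qed.

Lemma nsq_Qeff f : nsq (lin Qeff f) =
  \sum_a (effective a)%:R * cabs2 (f a) - cabs2 (dir_coef f).
Proof.
apply: cRI; rewrite -(inner_proj Qeff_herm Qeff_idem) cRB cR_sum cabs2E.
rewrite {1}/dir_coef cconj_sum mulr_suml -sumrB; apply: eq_bigr => a _.
by rewrite lin_Qeff cRM cR_nat cabs2E cconjM cconj_cR; ring.
Qed.

Definition unweigh {I : Type} (p : I -> R) (f : I -> C) (i : I) : C :=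
  cR (Num.sqrt (p i))^-1 * f i.

(** Only an inequality, since unweighting loses the values at null points. *)
Lemma unweigh_norm (I : finType) (p : I -> R) f : (forall i, 0 <= p i) ->
  norm1 p (unweigh p f) <= Num.sqrt (nsq f).
Proof.
move=> p0; rewrite ler_wsqrtr //; apply: ler_sum => i _.
rewrite cabs2M cabs2_cR exprVn sqr_sqrtr // mulrA.
have [->|pn] := eqVneq (p i) 0; first by rewrite !mul0r cabs2_ge0.
by rewrite mulfV // mul1r.
Qed.

Lemma triform_kernel f g h :
  triform kernel f g h = E1 mu T (unweigh px f) (unweigh py g) (unweigh pz h).
Proof.
rewrite /triform /E1 pair_bigA /=.
rewrite (reindex (fun t : Sg * Gm * Ph => (t.1.1, (t.1.2, t.2)))) /=; last first.
  by exists (fun p => (p.1, p.2.1, p.2.2)) => [[[a b] c]|[a [b c]]].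
apply: eq_bigr => -[[a b] c] _ /=.
by rewrite /kernel /unweigh /= !cRM; ring.
Qed.

(** [Ieff] is twice an unnormalized variance on [S'], and removing the mean is removing the [dir]
    component. *)
Lemma Ieff_unweigh f : Ieff mu S' (unweigh px f) = 2 * mass * nsq (lin Qeff f).
Proof.
set u := unweigh px f.
pose w a : R := px a * (a \in S')%:R.
have wm : \sum_a w a = mass.
  rewrite /mass [RHS]big_mkcond; apply: eq_bigr => a _; rewrite /w.
  by case: (a \in S'); rewrite ?mulr1 ?mulr0.
have we a : w a * cabs2 (u a) = (effective a)%:R * cabs2 (f a).
  rewrite /w /u /unweigh cabs2M cabs2_cR exprVn sqr_sqrtr ?margx_ge0 // /effective.
  case: (a \in S'); rewrite ?mulr0 ?mul0r //= mulr1 mulrA.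
  by have [->|pn] := eqVneq (px a) 0; rewrite ?mul0r // mulfV.
have wd : \sum_a cR (w a) * u a = cR (Num.sqrt mass) * dir_coef f.
  rewrite /dir_coef mulr_sumr; apply: eq_bigr => a _.
  rewrite /u /unweigh !mulrA -!cRM; congr (cR _ * _).
  have [ea|ne] := boolP (effective a); last first.
    rewrite dir_eq0 // mulr0 /w; move: ne; rewrite negb_and negbK.
    by move=> /orP[/negbTE ->|/eqP ->]; rewrite ?mulr0 !mul0r.
  have mp := effective_mass ea; case/andP: ea => aS pa.
  have sx : Num.sqrt (px a) != 0 by rewrite gt_eqF // sqrtr_gt0 lt_neqAle eq_sym pa margx_ge0.
  have sm : Num.sqrt mass != 0 by rewrite gt_eqF // sqrtr_gt0.
  rewrite /w /dir aS -{1}(sqr_sqrtr (margx_ge0 a)); field.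
  by rewrite sx sm.
transitivity (\sum_a \sum_a' w a * w a' * cabs2 (u a - u a')).
  apply: eq_bigr => a _; apply: eq_bigr => a' _; rewrite /w.
  by case: (a \in S'); case: (a' \in S'); rewrite /= ?mulr1 ?mulr0 ?mul0r.
(* The variance identity for the weight [w], of total mass [mass]. *)
have -> : \sum_a \sum_a' w a * w a' * cabs2 (u a - u a') =
   2 * (mass * \sum_a w a * cabs2 (u a)) - 2 * cabs2 (\sum_a cR (w a) * u a).
  clearbody u w; apply: cRI; rewrite cRB !cRM !(cR_nat 2) cabs2E -wm cconj_sum !cR_sum.
  have P (c d : Sg -> C) : (\sum_a c a) * (\sum_a d a) = \sum_a \sum_a' c a * d a'.
    by rewrite mulr_suml; apply: eq_bigr => a _; rewrite mulr_sumr.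
  transitivity (\sum_a \sum_a' cR (w a) * cR (w a' * cabs2 (u a')) +
    \sum_a \sum_a' cR (w a * cabs2 (u a)) * cR (w a') -
    \sum_a \sum_a' cconj (cR (w a) * u a) * (cR (w a') * u a') -
    \sum_a \sum_a' (cR (w a) * u a) * cconj (cR (w a') * u a')).
    rewrite -big_split -!sumrB; apply: eq_bigr => a _ /=.
    rewrite cR_sum -big_split -!sumrB; apply: eq_bigr => a' _ /=.
    rewrite !cRM !cabs2E !cconjM !cconj_cR cconjD cconjN; ring.
  by rewrite -!P; ring.
rewrite wd cabs2M cabs2_cR sqr_sqrtr ?mass_ge0 // nsq_Qeff.
under eq_bigr => a _ do rewrite we.
by ring.
Qed.

End SingleCoordinate.

(** * Transfer of the base case, and the eigenvectors of the projection *)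

Section Base.
Context {R : realType} {Sg Gm Ph : finType}.
Local Notation C := R[i].
Variables (mu : Sg * Gm * Ph -> R) (S' : {set Sg}) (T : Sg -> Gm -> Ph -> C).
Hypothesis mu_distr : is_distr mu.
Hypothesis T_disk : forall a b c, 0 < mu (a, b, c) -> inD (T a b c).
Hypothesis yz_indep : forall b c, margyz mu b c = margy mu b * margz mu c.
Hypothesis x_det : forall a a' b c, 0 < mu (a, b, c) -> 0 < mu (a', b, c) -> a = a'.

Local Notation px := (margx mu).
Local Notation Q := (Qeff mu S').
Local Notation K := (kernel mu T).

(* If S' is null then Qeff = 0, the premise forces t = 0 or f = 0, and c1 = 1 works. *)
Lemma triform_kernel_gain (c0 : R) (N : nat) : 0 < c0 ->
  (forall tau : R, 0 < tau -> forall F G H, tau * norm1 px F ^+ 2 <= Ieff mu S' F ->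
     cabs (E1 mu T F G H) <= (1 - c0 * tau ^+ N.+1) *
       norm1 px F * norm1 (margy mu) G * norm1 (margz mu) H) ->
  exists c1 : R, 0 < c1 <= 1 /\
  forall f g h t, 0 <= t -> t * nsq f <= nsq (lin Q f) ->
    cabs (triform K f g h) <=
    (1 - c1 * t ^+ N.+1) * Num.sqrt (nsq f) * Num.sqrt (nsq g) * Num.sqrt (nsq h).
Proof.
move=> c00 Hb; have m0 := mass_ge0 S' mu_distr; set m := mass mu S' in m0.
(* The factor [(2 m)^(N+1)] comes from applying the base case at [tau = 2 m t]. *)
pose c1 : R := if m == 0 then 1 else Num.min 1 (c0 * (2 * m) ^+ N.+1).
have c1_01 : 0 < c1 <= 1.
  rewrite /c1; case: eqVneq => [_|mn]; first by rewrite ltr01 lexx.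
  rewrite lt_min ltr01 ge_min lexx /= andbT mulr_gt0 // exprn_gt0 // mulr_gt0 //.
  by rewrite lt_neqAle eq_sym mn.
exists c1; split=> // f g h t t0 tf; case/andP: c1_01 => c10 c11.
have triv := triform_le (gram_kernel T mu_distr x_det)
  (col_nsq01 mu_distr T_disk yz_indep x_det) f g h.
have Q_le := nsq_proj_le (Qeff_herm mu S') (Qeff_idem S' mu_distr) f.
have [f0|fn] := eqVneq (nsq f) 0.
  by move: triv; rewrite f0 sqrtr0 mulr0 !mul0r.
have fp : 0 < nsq f by rewrite lt_neqAle eq_sym fn nsq_ge0.
have [t00|tn] := eqVneq t 0; first by rewrite t00 expr0n /= mulr0 subr0 mul1r.
have tp : 0 < t by rewrite lt_neqAle eq_sym tn.
have t1 : t <= 1.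
  by rewrite -(ler_pM2r fp) mul1r; apply: le_trans tf Q_le.
have mp : 0 < m.
  rewrite lt_neqAle m0 andbT eq_sym; apply/eqP => mz.
  have : nsq (lin Q f) = 0.
    rewrite /nsq big1 // => a _.
    have d b : dir mu S' b = 0.
      by apply: dir_eq0; apply/negP => /(effective_mass mu_distr); rewrite -/m mz ltxx.
    have ne : ~~ effective mu S' a.
      by apply/negP => /(effective_mass mu_distr); rewrite -/m mz ltxx.
    by rewrite lin_Qeff (negbTE ne) d mul0r cR0 mul0r subr0 cabs2_0.
  by move=> q0; have := mulr_gt0 tp fp; rewrite ltNge -q0 tf.
have tmp : 0 < 2 * m * t by rewrite !mulr_gt0.
set F := unweigh px f; set G := unweigh (margy mu) g; set H := unweigh (margz mu) h.
have nF := unweigh_norm f (margx_ge0 mu_distr); have nG := unweigh_norm g (margy_ge0 mu_distr).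
have nH := unweigh_norm h (margz_ge0 mu_distr).
have F2 : norm1 px F ^+ 2 <= nsq f.
  by rewrite -[leRHS]sqr_sqrtr ?nsq_ge0 // lerXn2r ?nnegrE ?sqrtr_ge0.
rewrite triform_kernel -/F -/G -/H; apply: le_trans (Hb _ tmp F G H _) _.
  rewrite Ieff_unweigh // -/m -mulrA ler_wpM2l ?mulr_ge0 //.
  by apply: le_trans tf; rewrite ler_wpM2l.
have cc : c1 * t ^+ N.+1 <= c0 * (2 * m * t) ^+ N.+1.
  rewrite exprMn mulrA ler_wpM2r ?exprn_ge0 // /c1 gt_eqF //.
  by rewrite ge_min lexx orbT.
(* As the constant is nonnegative, the weighted norms may be replaced by the larger unweighted
   ones. *)
have ct : 0 <= 1 - c1 * t ^+ N.+1.
  rewrite subr_ge0 mulr_ile1 ?exprn_ge0 ?exprn_ile1 //; exact: ltW.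
apply: (@le_trans _ _ ((1 - c1 * t ^+ N.+1) * norm1 px F * norm1 (margy mu) G * norm1 (margz mu) H)).
  by rewrite !ler_wpM2r ?sqrtr_ge0 // lerD2l lerN2.
rewrite -!mulrA ler_wpM2l //; apply: ler_pM; rewrite ?mulr_ge0 ?sqrtr_ge0 //.
by apply: ler_pM; rewrite ?sqrtr_ge0.
Qed.

(** On effective points the weighted [b] is a multiple of [dir], which the projection kills. *)
Lemma lin_Qeff_const b a : const_on S' b -> lin Q (weigh px b) a = 0.
Proof.
move=> bc; rewrite lin_Qeff.
have [ea|ne] := boolP (effective mu S' a); last first.
  by rewrite dir_eq0 // cR0 !mul0r subrr.
have mp := effective_mass mu_distr ea; case/andP: (ea) => aS _.
have sm : Num.sqrt (mass mu S') != 0 by rewrite gt_eqF // sqrtr_gt0.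
have dE a' : a' \in S' -> Num.sqrt (px a') = Num.sqrt (mass mu S') * dir mu S' a'.
  by move=> a'S; rewrite /dir a'S mul1r mulrC divfK.
have -> : dir_coef mu S' (weigh px b) = cR (Num.sqrt (mass mu S')) * b a.
  rewrite -[in RHS](mulr1 (Num.sqrt _)) -(sum_dir2 mu_distr mp) mulr_sumr cR_sum mulr_suml.
  apply: eq_bigr => a' _; rewrite /weigh mulrA -cRM.
  have [a'S|na] := boolP (a' \in S').
    by rewrite (bc a' a) // dE //; congr (cR _ * _); ring.
  have d0 : dir mu S' a' = 0 by rewrite dir_eq0 // /effective (negbTE na).
  by rewrite d0 expr0n /= mulr0 !mul0r.
rewrite mul1r mulrA -cRM [dir _ _ _ * _]mulrC -dE //.
by rewrite /weigh subrr.
Qed.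

(** Orthogonality to constants is orthogonality to [dir], and the weight removes the null points of
    [S']. *)
Lemma lin_Qeff_supp b a : supp_orth px S' b -> lin Q (weigh px b) a = weigh px b a.
Proof.
case=> b0 bo; rewrite lin_Qeff.
have -> : dir_coef mu S' (weigh px b) = 0.
  transitivity (cR (Num.sqrt (mass mu S'))^-1 * ip1 px b (fun => 1)); last by rewrite bo mulr0.
  rewrite /ip1 mulr_sumr; apply: eq_bigr => a' _; rewrite cconj1 mulr1 /weigh !mulrA -!cRM.
  have [a'S|/b0 ->] := boolP (a' \in S'); last by rewrite !mulr0.
  congr (cR _ * _).
  by rewrite /dir a'S mul1r -[in RHS](sqr_sqrtr (margx_ge0 mu_distr a')); ring.
rewrite mulr0 subr0; have [|] := boolP (effective mu S' a); first by rewrite mul1r.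
rewrite /effective negb_and negbK mul0r /weigh => /orP[/b0 ->|/eqP ->]; first by rewrite mulr0.
by rewrite sqrtr0 cR0 mul0r.
Qed.

End Base.

(** * Effective degree and the final estimate *)

Section AmplifiedKernel.
Context {R : realType} {X Y Z : finType}.
Local Notation C := R[i].
Variables (K : X -> Y * Z -> C) (Q : X -> X -> C) (rho : R).

(** Kernel of A(1 + rho Q), so that the twisted form is again a [power_form]. *)
Definition amplified_kernel (x : X) (t : Y * Z) : C :=
  K x t + cR rho * \sum_x' K x' t * Q x' x.

Lemma sum_amplified_kernel f t :
  \sum_x amplified_kernel x t * f x = \sum_x K x t * (f x + cR rho * lin Q f x).
Proof.
transitivity (\sum_x K x t * f x + cR rho * \sum_x \sum_x' K x' t * Q x' x * f x).
  rewrite mulr_sumr -big_split; apply: eq_bigr => x _ /=.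
  by rewrite mulrDl -mulr_suml -mulrA.
rewrite exchange_big mulr_sumr -big_split; apply: eq_bigr => x _ /=.
rewrite mulrDr; congr (_ + _); rewrite [RHS]mulrCA; congr (_ * _); rewrite /lin mulr_sumr.
by apply: eq_bigr => x' _; rewrite mulrA.
Qed.

Lemma power_form_split (K' : X -> Y * Z -> C) n F G H :
  @power_form _ _ _ _ K' n F G H =
  \sum_(y : {ffun 'I_n -> Y}) \sum_(z : {ffun 'I_n -> Z}) (\sum_(x : {ffun 'I_n -> X}) (\prod_i K' (x i) (y i, z i)) * F x) *
    (G y * H z).
Proof.
rewrite /power_form sum_ffun_pair exchange_big sum_ffun_pair /=.
apply: eq_bigr => y _; apply: eq_bigr => z _; rewrite mulr_suml; apply: eq_bigr => x _.
congr (_ * F _ * (G _ * H _)); try by apply/ffunP => i; rewrite !ffunE.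
by apply: eq_bigr => i _; rewrite !ffunE.
Qed.

(** Each term of [F] is a tensor of eigenvectors of [Q] with eigenvalues 0 and 1; exactly [d]
    coordinates have eigenvalue 1, each giving a factor [1 + rho]. *)
Lemma power_form_eigen (J : finType) n (e : J -> bool) (beta : J -> X -> C)
    (P : pred {ffun 'I_n -> J}) (co : {ffun 'I_n -> J} -> C) d
    (F : {ffun 'I_n -> X} -> C) G H :
  (forall j x, lin Q (beta j) x = (e j)%:R * beta j x) ->
  (forall chi, P chi -> (\sum_i e (chi i))%N = d) ->
  (forall x, F x = \sum_(chi | P chi) co chi * \prod_i beta (chi i) (x i)) ->
  @power_form _ _ _ _ amplified_kernel n F G H =
  cR ((1 + rho) ^+ d) * @power_form _ _ _ _ K n F G H.
Proof.
move=> He Hd HF; rewrite !power_form_split mulr_sumr; apply: eq_bigr => y _.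
rewrite mulr_sumr; apply: eq_bigr => z _; rewrite [RHS]mulrA; congr (_ * _).
have S (K' : X -> Y * Z -> C) : \sum_(x : {ffun 'I_n -> X}) (\prod_i K' (x i) (y i, z i)) * F x =
    \sum_(chi | P chi) co chi * \prod_i \sum_x K' x (y i, z i) * beta (chi i) x.
  under eq_bigr => x _ do rewrite HF mulr_sumr.
  rewrite exchange_big; apply: eq_bigr => chi _ /=.
  rewrite bigA_distr_bigA mulr_sumr; apply: eq_bigr => x _ /=.
  by rewrite mulrCA -big_split.
rewrite !S mulr_sumr; apply: eq_bigr => chi /Hd <-.
rewrite mulrCA; congr (_ * _); rewrite -prodrXr cR_prod -big_split.
apply: eq_bigr => i _ /=; rewrite sum_amplified_kernel mulr_sumr; apply: eq_bigr => x _.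
rewrite He; case: (e _); rewrite /= ?expr1 ?expr0 ?cRD ?cR1; ring.
Qed.

End AmplifiedKernel.

(** * Product weights, the original form, and the numerical decay *)

Section PowerWeights.
Context {R : realType} {X : finType} (p : X -> R) (n : nat).
Hypothesis p_ge0 : forall x, 0 <= p x.

Lemma normnE (F : {ffun 'I_n -> X} -> R[i]) : normn p F = Num.sqrt (nsq (weigh (prodw p) F)).
Proof.
congr Num.sqrt; apply: eq_bigr => x _.
by rewrite cabs2M cabs2_cR sqr_sqrtr //; apply: prodr_ge0.
Qed.

End PowerWeights.

Lemma En_power_form (R : realType) (Sg Gm Ph : finType) (mu : Sg * Gm * Ph -> R)
    (T : Sg -> Gm -> Ph -> R[i]) n F G H : is_distr mu ->
  @En _ _ _ _ n mu T F G H =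
  power_form (kernel mu T) (weigh (prodw (margx mu)) F) (weigh (prodw (margy mu)) G)
    (weigh (prodw (margz mu)) H).
Proof.
move=> md; rewrite power_form_split /En !sum_ffun_pair exchange_big; apply: eq_bigr => y _ /=.
rewrite exchange_big; apply: eq_bigr => z _ /=.
rewrite mulr_suml; apply: eq_bigr => x _.
transitivity ((\prod_i (cR (mu (x i, y i, z i)) * T (x i) (y i) (z i))) * F x * (G y * H z)).
  rewrite big_split /= -cR_prod -!mulrA; congr (cR _ * _).
    by apply: eq_bigr => i _; rewrite !ffunE.
  rewrite [RHS]mulrCA; congr (F _ * _); first by apply/ffunP => i; rewrite !ffunE.
  rewrite [RHS]mulrC -!mulrA; congr (G _ * (H _ * _)); try by apply/ffunP => i; rewrite !ffunE.
  by apply: eq_bigr => i _; rewrite !ffunE.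
under eq_bigr => i _ do rewrite kernelE //.
rewrite !big_split /= -!cR_prod -!sqrtr_prod.
- by rewrite /weigh /prodw; ring.
- by move=> i; apply: margz_ge0.
- by move=> i; apply: margy_ge0.
- by move=> i; apply: margx_ge0.
Qed.

(** With [y] the exponent on the right, [n t0 = d / 6] makes the left side at most [exp y], while
    [(1 + rho)^d] is at least [exp (2 y)]. *)
Lemma decay_le (R : realType) (g : R) (n d k : nat) :
  0 <= g -> (d <= n)%N ->
  let t0 := d%:R / (6 * n%:R) in
  let rho := 2 / 3 * (g * t0 ^+ k.+1) in
  rho <= 1 ->
  (1 + g * t0 ^+ k.+2) ^+ n <=
  2 `^ (- (g / 6 ^+ k.+2 * d%:R * (d%:R / n%:R) `^ k.+1%:R)) * (1 + rho) ^+ d.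
Proof.
move=> g0 dn t0 rho rho1.
have t00 : 0 <= t0 by rewrite divr_ge0 // mulr_ge0 // ler0n.
have p0 : 0 <= g * t0 ^+ k.+1 by rewrite mulr_ge0 // exprn_ge0.
have rho0 : 0 <= rho by rewrite /rho mulr_ge0 // divr_ge0.
have nt0 : n%:R * t0 = d%:R / 6.
  (* For [n = 0] also [d = 0], and [0 / 0 = 0] keeps the identity true. *)
  rewrite /t0; have [n0|nn] := eqVneq n 0%N.
    by move: dn; rewrite n0 leqn0 => /eqP ->; rewrite !mul0r.
  by field; rewrite pnatr_eq0.
have -> : g / 6 ^+ k.+2 * d%:R * (d%:R / n%:R) `^ k.+1%:R = g * t0 ^+ k.+1 * (d%:R / 6).
  rewrite powR_mulrn ?divr_ge0 ?ler0n //.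
  have -> : t0 = d%:R / n%:R * 6^-1 by rewrite /t0 invfM; ring.
  rewrite [in RHS]exprMn exprVn [6 ^+ k.+2]exprS.
  have s0 : 6 ^+ k.+1 != 0 :> R by rewrite expf_neq0 // pnatr_eq0.
  by move: (6 ^+ k.+1) s0 ((d%:R / n%:R) ^+ k.+1) => q q0 z; field.
set y := g * t0 ^+ k.+1 * (d%:R / 6).
have y0 : 0 <= y by rewrite mulr_ge0 // divr_ge0 // ler0n.
have step1 : (1 + g * t0 ^+ k.+2) ^+ n <= expR y.
  have -> : y = n%:R * (g * t0 ^+ k.+2) by rewrite /y -nt0 [t0 ^+ k.+2]exprSr; ring.
  rewrite expRM_natl lerXn2r ?nnegrE ?expR_ge0 //; last exact: expR_ge1Dx.
  by rewrite addr_ge0 // mulr_ge0 // exprn_ge0.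
have step2 : expR (y + y) <= (1 + rho) ^+ d.
  have -> : y + y = d%:R * (rho / 2) by rewrite /y /rho; field.
  rewrite expRM_natl lerXn2r ?nnegrE ?expR_ge0 //; first by rewrite addr_ge0.
  (* [exp (rho / 2) <= 1 + rho] on [[0, 1]], because [(1 + rho)(1 - rho / 2) >= 1]. *)
  have e1 := expR_ge1Dx (- (rho / 2)); have e2 := expRxMexpNx_1 (rho / 2).
  have e0 := expR_gt0 (rho / 2).
  rewrite -(ler_pM2r (expR_gt0 (- (rho / 2)))) e2.
  apply: le_trans (ler_wpM2l _ e1); last by rewrite addr_ge0.
  have : rho * rho <= rho by rewrite -[leRHS]mul1r ler_wpM2r.
  by nra.
apply: le_trans step1 _.
have : expR (- y) * expR (y + y) <= 2 `^ (- y) * (1 + rho) ^+ d.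
  apply: ler_pM => //; rewrite ?expR_ge0 //.
  (* Passing to base 2 uses [ln 2 <= 1]. *)
  rewrite /powR pnatr_eq0 /= ler_expR -[leLHS]mulr1 !mulNr lerN2 ler_wpM2l //.
  by apply: (@le_ln1Dx R 1); lra.
by rewrite -expRD addKr.
Qed.

Lemma effdegE (I1 I2 : finType) n (chi : {ffun 'I_n -> (I1 + I2)%type}) :
  (\sum_i is_inr (chi i))%N = effdeg chi.
Proof.
rewrite /effdeg -sum1dep_card [RHS]big_mkcond; apply: eq_bigr => i _.
by case: (is_inr _).
Qed.

Lemma effdeg_le (I1 I2 : finType) n (chi : {ffun 'I_n -> (I1 + I2)%type}) :
  (effdeg chi <= n)%N.
Proof. by rewrite -[leqRHS]card_ord; apply: max_card. Qed.

(** Equality in L2 becomes pointwise after weighting, since null points get the value 0 on both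
    sides. *)
Lemma eff_homog_weigh (R : realType) (X I1 I2 : finType) n (p : X -> R)
    (b1 : I1 -> X -> R[i]) (b2 : I2 -> X -> R[i]) d (F : {ffun 'I_n -> X} -> R[i]) :
  (forall x, 0 <= p x) -> eff_homog p b1 b2 d F ->
  forall x, weigh (prodw p) F x =
    \sum_(chi : {ffun 'I_n -> (I1 + I2)%type} | effdeg chi == d)
      fhat p b1 b2 F chi * \prod_i weigh p (bsum b1 b2 (chi i)) (x i).
Proof.
move=> p0; rewrite /eff_homog normnE // => /eqP; rewrite sqrtr_eq0 => le0 x.
have : nsq (weigh (prodw p) (fun x => F x -
    \sum_(chi : {ffun 'I_n -> (I1 + I2)%type} | effdeg chi == d)
        fhat p b1 b2 F chi * tens b1 b2 chi x)) = 0.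
  by apply/eqP; rewrite eq_le le0 nsq_ge0.
move=> /nsq_eq0/(_ x)/eqP; rewrite {1}/weigh mulrBr subr_eq0 => /eqP.
rewrite /weigh => ->; rewrite mulr_sumr; apply: eq_bigr => chi _.
rewrite mulrCA; congr (_ * _).
by rewrite /tens /prodw sqrtr_prod // cR_prod -big_split.
Qed.

Theorem theorem4p12 (R : realType) (Sg Gm Ph : finType)
  (mu : Sg * Gm * Ph -> R) (S' : {set Sg}) (T : Sg -> Gm -> Ph -> R[i]) :
  is_distr mu ->
  (forall a b c, 0 < mu (a, b, c) -> inD (T a b c)) ->
  nonembeddable mu T ->
  relaxed_base_case mu S' T ->
  exists c C : R, 0 < c /\ 0 < C /\
    forall (n d : nat) (I1 I2 : finType)
           (b1 : I1 -> Sg -> R[i]) (b2 : I2 -> Sg -> R[i]),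
      eff_basis (margx mu) S' b1 b2 ->
      forall (F : {ffun 'I_n -> Sg} -> R[i]) (G : {ffun 'I_n -> Gm} -> R[i])
             (H : {ffun 'I_n -> Ph} -> R[i]),
        eff_homog (margx mu) b1 b2 d F ->
        cabs (En mu T F G H) <=
          2 `^ (- (c * d%:R * (d%:R / n%:R) `^ C)) *
            normn (margx mu) F * normn (margy mu) G * normn (margz mu) H.
Proof.
move=> md Td _ [yz xd [c0 [c00 Hb]]].
(* [Sg] is nonempty since [mu] has mass 1, so the exponent is a successor [N.+1]. *)
have M0 : (0 < 100 * maxn #|Sg| (maxn #|Gm| #|Ph|))%N.
  rewrite muln_gt0 /= leq_max; apply/orP; left; rewrite lt0n; apply/eqP => S0.
  case: md => _ /eqP; rewrite big1 ?(eq_sym 0) ?oner_eq0 // => t _.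
  by have := fintype0 t.1.1 S0.
move: M0 Hb; case: (100 * _)%N => // N _ Hb.
have [c1 [c1_01 base]] := triform_kernel_gain md Td yz xd c00 Hb.
set K := kernel mu T in base; set Q := Qeff mu S' in base.
have gK := gram_kernel T md xd; have s01 := col_nsq01 md Td yz xd.
have Qh := Qeff_herm mu S'; have Qi := Qeff_idem S' md.
have Q_le := nsq_proj_le Qh Qi; have Qo := nsq_proj Qh Qi.
pose g := gain K Q c1 N.
have g0 : 0 < g by exact: (gain_gt0 K Q N c1_01).
have g1 : g <= 1 by exact: (gain_le1 K Q N c1_01).
exists (g / 6 ^+ (2 * N).+2), (2 * N).+1%:R; split; first by rewrite divr_gt0 ?exprn_gt0.
split; first by rewrite ltr0n.
move=> n d I1 I2 b1 b2 [[b1c _ _] _ [b2s _ _] _] F G H hF.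
have p0 := margx_ge0 md.
have wF := eff_homog_weigh p0 hF.
rewrite (normnE p0) (normnE (margy_ge0 md)) (normnE (margz_ge0 md)).
rewrite En_power_form //; set wf := weigh _ F; set wg := weigh _ G; set wh := weigh _ H.
(* No tensor has effective degree above [n], so for [d > n] the weighted [F] vanishes. *)
have [dn|nd] := leqP d n; last first.
  have wf0 x : wf x = 0.
    rewrite /wf wF big_pred0 // => chi; apply/negbTE; rewrite neq_ltn.
    by rewrite (leq_ltn_trans (effdeg_le chi) nd).
  rewrite /power_form big1 => [|w _]; last by rewrite wf0 mulr0 mul0r.
  by rewrite cabs0 !mulr_ge0 ?sqrtr_ge0 ?powR_ge0.
pose t0 : R := d%:R / (6 * n%:R); pose rho := 2 / 3 * (g * t0 ^+ (2 * N).+1).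
have t00 : 0 <= t0 by rewrite divr_ge0 // mulr_ge0 // ler0n.
have t01 : t0 <= 1.
  rewrite /t0; have [n0|np] := posnP n; first by rewrite n0 mulr0 invr0 mulr0.
  rewrite ler_pdivrMr ?mulr_gt0 ?ltr0n // mul1r -natrM ler_nat.
  by apply: leq_trans dn _; apply: leq_pmull.
have rho01 : 0 <= rho <= 1.
  have q0 : 0 <= g * t0 ^+ (2 * N).+1 by rewrite mulr_ge0 ?exprn_ge0 // ltW.
  have q1 : g * t0 ^+ (2 * N).+1 <= 1 by rewrite mulr_ile1 ?exprn_ge0 ?exprn_ile1 // ltW.
  by rewrite /rho; apply/andP; split; lra.
have rhoE : 3 / 2 * rho = g * t0 ^+ (2 * N).+1 by rewrite /rho; field.
pose alpha := 1 + g * t0 ^+ (2 * N).+2.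
have alpha0 : 0 <= alpha by rewrite addr_ge0 // mulr_ge0 ?exprn_ge0 // ltW.
have step := @power_form_le R Sg Gm Ph (amplified_kernel K Q rho) alpha alpha0.
have bound : cabs (power_form (amplified_kernel K Q rho) wf wg wh) <=
    alpha ^+ n * (Num.sqrt (nsq wf) * (Num.sqrt (nsq wg) * Num.sqrt (nsq wh))).
  apply: step => V U W Om ka pv pu pw e e0 He f g' h'.
  have := tensor_step gK s01 Q_le c1_01 base Qi Qo t00 rho01 rhoE e0 He f g' h'.
  congr (cabs _ <= _); apply: eq_bigr => t _; apply: eq_bigr => o _.
  by rewrite sum_amplified_kernel.
have eig j x : lin Q (weigh (margx mu) (bsum b1 b2 j)) x =
    (is_inr j)%:R * weigh (margx mu) (bsum b1 b2 j) x.
  case: j => j /=; first by rewrite mul0r; apply: lin_Qeff_const.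
  by rewrite mul1r; apply: lin_Qeff_supp.
have deg (chi : {ffun 'I_n -> (I1 + I2)%type}) : effdeg chi == d ->
    (\sum_i is_inr (chi i))%N = d by rewrite effdegE => /eqP.
(* By homogeneity the twisted form is [(1 + rho)^d] times the original one; dividing by this factor
   leaves the inequality of [decay_le]. *)
move: bound; rewrite (power_form_eigen K rho wg wh eig deg wF).
have r0 : 0 < (1 + rho) ^+ d.
  by rewrite exprn_gt0 // ltr_pwDl //; case/andP: rho01.
rewrite cabsM cabs_cR (ger0_norm (ltW r0)) => bound.
rewrite -(ler_pM2l r0); apply: le_trans bound _.
have D := @decay_le R g n d (2 * N) (ltW g0) dn; rewrite /= -/t0 -/rho -/alpha in D.
have {}D := D (proj2 (andP rho01)).
set E := 2 `^ _ in D *.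
have -> : (1 + rho) ^+ d * (E * Num.sqrt (nsq wf) * Num.sqrt (nsq wg) * Num.sqrt (nsq wh)) =
  E * (1 + rho) ^+ d * (Num.sqrt (nsq wf) * (Num.sqrt (nsq wg) * Num.sqrt (nsq wh))) by ring.
by apply: ler_wpM2r D; rewrite !mulr_ge0 ?sqrtr_ge0.
Qed.
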